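(* Let $\rho\in\mathbb{R}_{>0}^n$. Then every finite projective module over $K_{[\rho,\rho],n}$ is free.
   Context: Fix a prime $p$, a complete nonarchimedean field $K$ of mixed characteristic $(0,p)$ with norm $|\cdot|$, $|p|=p^{-1}$, and a positive integer $n$. For $\rho=(\rho_1,\dots,\rho_n)\in\mathbb{R}_{>0}^n$, $K_{[\rho,\rho],n}$ is the ring of Laurent series $\sum_{i\in\mathbb{Z}^n}f_it^i$ ($f_i\in K$, $t^i=t_1^{i_1}\cdots t_n^{i_n}$) with $\lim_{|i|\to\infty}|f_i|\rho^i=0$, where $\rho^i=\rho_1^{i_1}\cdots\rho_n^{i_n}$ and $|i|=|i_1|+\cdots+|i_n|$. *)

(* Defs.v *)
From HB Require Import structures.
From mathcomp Require Import all_boot all_order all_algebra finmap.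
From mathcomp Require Import mathcomp_extra boolp classical_sets functions.
From mathcomp Require Import reals interval_inference.
From mathcomp Require Import ring lra.

Set Implicit Arguments.
Unset Strict Implicit.
Unset Printing Implicit Defensive.

Import Order.TTheory GRing.Theory Num.Theory.
Local Open Scope fset_scope.
Local Open Scope ring_scope.

(* The norm takes its values in R rather than in K, and the hierarchy of       *)
(* numeric structures admits no join of Num.NormedZmodule with fieldType, so   *)
(* the R-valued absolute value is carried by a separate mixin.                 *)
HB.mixin Record isCompleteNonarchimedean (R : realType) K & GRing.Field K := {
  nanorm : K -> R;
  nanorm_ge0 : forall x, 0 <= nanorm x;
  nanorm_eq0 : forall x, (nanorm x == 0) = (x == 0);
  nanormM : forall x y, nanorm (x * y) = nanorm x * nanorm y;
  nanormD : forall x y, nanorm (x + y) <= Num.max (nanorm x) (nanorm y);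
  nanorm_complete : forall u : nat -> K,
    (forall e, 0 < e -> exists N, forall i j,
       (N <= i)%N -> (N <= j)%N -> nanorm (u i - u j) < e) ->
    exists l : K, forall e, 0 < e -> exists N, forall i,
       (N <= i)%N -> nanorm (l - u i) < e
}.

#[short(type="completeNonarchFieldType")]
HB.structure Definition CompleteNonarchField (R : realType) :=
  {K of GRing.Field K & isCompleteNonarchimedean R K}.

(* The residue field of K is the quotient of {|x| <= 1} by {|x| < 1}, so it    *)
(* has characteristic p exactly when the prime p satisfies |p| < 1.            *)
Definition mixed_characteristic (R : realType) (K : completeNonarchFieldType R)
    (p : nat) : Prop :=
  [/\ prime p, [pchar K] =i pred0 & nanorm (p%:R : K) < 1].

Section NormTheory.
Context (R : realType) (K : completeNonarchFieldType R).
Implicit Types x y z : K.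

Lemma nanorm0 : nanorm (0 : K) = 0.
Proof. by apply/eqP; rewrite nanorm_eq0. Qed.

Lemma nanorm1 : nanorm (1 : K) = 1.
Proof.
have n0 : nanorm (1 : K) != 0 by rewrite nanorm_eq0 oner_neq0.
by apply: (mulfI n0); rewrite -nanormM !mulr1.
Qed.

Lemma nanormN x : nanorm (- x) = nanorm x.
Proof.
suff e1 : nanorm (-1 : K) = 1 by rewrite -mulN1r nanormM e1 mul1r.
have : nanorm (-1 : K) ^+ 2 = 1 by rewrite expr2 -nanormM mulrNN mulr1 nanorm1.
move/eqP; rewrite sqrf_eq1 => /orP[/eqP//|/eqP e1].
by have := nanorm_ge0 (-1 : K); rewrite e1 oppr_ge0 ler10.
Qed.

Lemma nanormDist x y : nanorm (x - y) = nanorm (y - x).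
Proof. by rewrite -nanormN opprB. Qed.

Lemma nanormD_le x y e : nanorm x <= e -> nanorm y <= e -> nanorm (x + y) <= e.
Proof. by move=> xe ye; rewrite (le_trans (nanormD x y))// ge_max xe. Qed.

Lemma nanormD_lt x y e : nanorm x < e -> nanorm y < e -> nanorm (x + y) < e.
Proof. by move=> xe ye; rewrite (le_lt_trans (nanormD x y))// gt_max xe. Qed.

Lemma nanorm_sum (I : Type) (r : seq I) (P : pred I) (F : I -> K) e :
  0 <= e -> (forall i, P i -> nanorm (F i) <= e) ->
  nanorm (\sum_(i <- r | P i) F i) <= e.
Proof.
move=> e0 Fe; elim/big_ind: _ => //; first by rewrite nanorm0.
by move=> x y; exact: nanormD_le.
Qed.

Lemma nanorm_le0 x : (forall e, 0 < e -> nanorm x <= e) -> x = 0.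
Proof.
move=> xe; apply/eqP; rewrite -nanorm_eq0; apply/negPn/negP => n0.
have xp : 0 < nanorm x by rewrite lt_neqAle eq_sym n0 nanorm_ge0.
have := xe (nanorm x / 2); rewrite divr_gt0// => /(_ isT); lra.
Qed.

End NormTheory.

Section Summation.
Context (R : realType) (K : completeNonarchFieldType R).

Definition null_family (I : choiceType) (F : I -> K) : Prop :=
  forall e : R, 0 < e -> exists A : {fset I}, forall i, i \notin A ->
    nanorm (F i) <= e.

Definition has_sum (I : choiceType) (F : I -> K) (s : K) : Prop :=
  forall e : R, 0 < e -> exists A : {fset I}, forall B : {fset I}, A `<=` B ->
    nanorm (s - \sum_(i <- B) F i) < e.

(* Unordered sum of a family; it is 0 when the family is not summable. *)
Definition infsum (I : choiceType) (F : I -> K) : K := xget 0 (has_sum F).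

Section OneIndex.
Context (I : choiceType).
Implicit Types (F G : I -> K) (A B : {fset I}).

Lemma sum_fsetD F A B : A `<=` B ->
  \sum_(i <- B) F i = \sum_(i <- A) F i + \sum_(i <- B `\` A) F i.
Proof.
move=> AB; rewrite (big_fsetID _ (mem A)) /=; congr (_ + _).
  apply: eq_fbigl => i; rewrite !inE /=; apply: andb_idl; exact: fsubsetP.
by apply: eq_fbigl => i; rewrite !inE /= andbC.
Qed.

Lemma fin_tail F A B e : 0 <= e -> (forall i, i \notin A -> nanorm (F i) <= e) ->
  A `<=` B -> nanorm (\sum_(i <- B) F i - \sum_(i <- A) F i) <= e.
Proof.
move=> e0 Fe AB; rewrite (sum_fsetD F AB) addrC addKr.
rewrite big_seq; apply: nanorm_sum => // i; rewrite inE => /andP[iA _].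
exact: Fe.
Qed.

Lemma has_sum_tail F A s e : 0 <= e ->
  (forall i, i \notin A -> nanorm (F i) <= e) ->
  has_sum F s -> nanorm (s - \sum_(i <- A) F i) <= e.
Proof.
move=> e0 Fe Fs; rewrite leNgt; apply/negP => es.
have [A' A's] := Fs _ (le_lt_trans e0 es).
have := A's (A `|` A') (fsubsetUr _ _).
have /le_lt_trans/(_ es) := fin_tail e0 Fe (fsubsetUl A A').
move=> h2 h1; have := nanormD_lt h1 h2.
by rewrite subrKA ltxx.
Qed.

Lemma has_sum_le F s e : 0 <= e -> (forall i, nanorm (F i) <= e) ->
  has_sum F s -> nanorm s <= e.
Proof.
move=> e0 Fe /(@has_sum_tail F fset0 s e e0).
by rewrite big_seq_fset0 subr0; apply => i _.
Qed.

Lemma has_sum_uniq F s t : has_sum F s -> has_sum F t -> s = t.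
Proof.
move=> Fs Ft; apply/eqP; rewrite -subr_eq0; apply/eqP/nanorm_le0 => e e0.
have [A As] := Fs _ e0; have [B Bt] := Ft _ e0.
have h1 := As (A `|` B) (fsubsetUl _ _).
have := Bt (A `|` B) (fsubsetUr _ _); rewrite nanormDist => h2.
by have := nanormD_lt h1 h2; rewrite subrKA => /ltW.
Qed.

Lemma has_sumE F s : has_sum F s -> infsum F = s.
Proof.
by move=> Fs; apply: (has_sum_uniq _ Fs); exact: (xgetI (P := has_sum F) 0 Fs).
Qed.

Lemma has_sumD F G s t : has_sum F s -> has_sum G t ->
  has_sum (fun i => F i + G i) (s + t).
Proof.
move=> Fs Gt e e0; have [A As] := Fs _ e0; have [B Bt] := Gt _ e0.
exists (A `|` B) => C; rewrite fsubUset => /andP[AC BC].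
by rewrite big_split opprD addrACA; apply: nanormD_lt; [exact: As|exact: Bt].
Qed.

Lemma has_sumMl F s c : has_sum F s -> has_sum (fun i => c * F i) (c * s).
Proof.
move=> Fs e e0; have [->|c0] := eqVneq c 0.
  exists fset0 => B _; rewrite mul0r big1 ?subr0 ?nanorm0// => i _.
  by rewrite mul0r.
have cp : 0 < nanorm c by rewrite lt_neqAle eq_sym nanorm_eq0 c0 nanorm_ge0.
have [A As] := Fs _ (divr_gt0 e0 cp).
exists A => B AB; rewrite -mulr_sumr -mulrBr nanormM mulrC -ltr_pdivlMr//.
exact: As.
Qed.

Lemma has_sum_fin F A : (forall i, i \notin A -> F i = 0) ->
  has_sum F (\sum_(i <- A) F i).
Proof.
move=> F0 e e0; exists A => B AB; rewrite nanormDist.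
apply: (@le_lt_trans _ _ 0) => //; apply: fin_tail => // i /F0 ->.
by rewrite nanorm0.
Qed.

Lemma null_has_sum F : null_family F -> has_sum F (infsum F).
Proof.
move=> F0; suff [s Fs] : exists s, has_sum F s by rewrite (has_sumE Fs).
have hk (k : nat) : 0 < k.+1%:R^-1 :> R by rewrite invr_gt0.
have [A hA] := choice (fun k => F0 _ (hk k)).
have small (e : R) : 0 < e -> exists N, forall k, (N <= k)%N -> k.+1%:R^-1 < e.
  move=> e0; exists (Num.truncn e^-1) => k Nk.
  rewrite invf_plt ?posrE//; apply: (lt_le_trans (truncnS_gt _)).
  by rewrite ler_nat ltnS.
have key k B : A k `<=` B ->
    nanorm (\sum_(i <- B) F i - \sum_(i <- A k) F i) <= k.+1%:R^-1.
  by apply: fin_tail; [exact: ltW|exact: hA].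
have [e e0|l hl] := nanorm_complete (fun k => \sum_(i <- A k) F i).
  have [N hN] := small _ e0; exists N => i j Ni Nj.
  have h1 := le_lt_trans (key i _ (fsubsetUl (A i) (A j))) (hN _ Ni).
  have h2 := le_lt_trans (key j _ (fsubsetUr (A i) (A j))) (hN _ Nj).
  rewrite nanormDist in h1; have := nanormD_lt h1 h2.
  by rewrite subrKA.
exists l => e e0; have [N1 h1] := hl _ e0; have [N2 h2] := small _ e0.
exists (A (maxn N1 N2)) => B /key kB.
have {}kB := le_lt_trans kB (h2 _ (leq_maxr _ _)); rewrite nanormDist in kB.
by have := nanormD_lt (h1 _ (leq_maxl _ N2)) kB; rewrite subrKA.
Qed.

Lemma infsum_le F e : 0 <= e -> null_family F -> (forall i, nanorm (F i) <= e) ->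
  nanorm (infsum F) <= e.
Proof. by move=> e0 /null_has_sum Fs Fe; apply: has_sum_le Fs. Qed.

Lemma infsumMl F c : null_family F ->
  c * infsum F = infsum (fun i => c * F i).
Proof. by move=> /null_has_sum/(has_sumMl c)/has_sumE. Qed.

End OneIndex.

Lemma has_sum_reindex (I J : choiceType) (h : I -> J) (h' : J -> I)
    (F : J -> K) s :
  cancel h h' -> cancel h' h -> has_sum F s -> has_sum (F \o h) s.
Proof.
move=> hK h'K Fs e e0; have [A As] := Fs _ e0.
exists [fset h' j | j in A] => B AB.
have := As [fset h i | i in B].
rewrite big_imfset/=; last by move=> x y _ _; exact: (can_inj hK).
apply; apply/fsubsetP => j jA; rewrite -(h'K j); apply/imfsetP.
exists (h' j) => //=; apply: (fsubsetP AB); apply/imfsetP.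
by exists j.
Qed.

Lemma infsum_exchange_half (I J : choiceType) (F : I -> J -> K)
    (A : {fset I}) (B : {fset J}) (e : R) : 0 <= e ->
  (forall i, null_family (F i)) -> null_family (fun i => infsum (F i)) ->
  (forall i j, (i \notin A) || (j \notin B) -> nanorm (F i j) <= e) ->
  nanorm (infsum (fun i => infsum (F i)) -
          \sum_(i <- A) \sum_(j <- B) F i j) <= e.
Proof.
move=> e0 Fi Fs Fe.
rewrite -(subrKA (\sum_(i <- A) infsum (F i))); apply: nanormD_le.
  apply: has_sum_tail => // [i iA|]; last exact: null_has_sum.
  by apply: infsum_le => // j; apply: Fe; rewrite iA.
rewrite -sumrB; apply: nanorm_sum => // i _.
apply: has_sum_tail => // [j jB|]; last exact: null_has_sum.
by apply: Fe; rewrite jB orbT.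
Qed.

Lemma null_family_row (I J : choiceType) (F : I -> J -> K) :
  null_family (fun p => F p.1 p.2) -> forall i, null_family (F i).
Proof.
move=> F0 i e e0; have [A hA] := F0 _ e0.
exists [fset p.2 | p in A] => j jA; apply: (hA (i, j)).
by apply: contraNN jA => ijA; apply/imfsetP; exists (i, j).
Qed.

Lemma null_family_sum (I J : choiceType) (F : I -> J -> K) :
  null_family (fun p => F p.1 p.2) -> null_family (fun i => infsum (F i)).
Proof.
move=> F0 e e0; have [A hA] := F0 _ e0.
exists [fset p.1 | p in A] => i iA; apply: infsum_le; first exact: ltW.
  exact: null_family_row.
move=> j; apply: (hA (i, j)).
by apply: contraNN iA => ijA; apply/imfsetP; exists (i, j).
Qed.

Lemma infsum_exchange (I J : choiceType) (F : I -> J -> K) :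
  null_family (fun p => F p.1 p.2) ->
  infsum (fun i => infsum (F i)) = infsum (fun j => infsum (F^~ j)).
Proof.
move=> F0.
have F0' : null_family (fun p => F p.2 p.1).
  move=> e e0; have [A hA] := F0 _ e0; exists [fset (p.2, p.1) | p in A].
  case=> j i ijA; apply: (hA (i, j)); apply: contraNN ijA => ijA.
  by apply/imfsetP; exists (i, j).
apply/eqP; rewrite -subr_eq0; apply/eqP/nanorm_le0 => e e0.
have [S hS] := F0 _ e0.
pose A := [fset p.1 | p in S]; pose B := [fset p.2 | p in S].
have Fe i j : (i \notin A) || (j \notin B) -> nanorm (F i j) <= e.
  move=> ij; apply: (hS (i, j)); apply: contraL ij => ij.
  rewrite negb_or !negbK; apply/andP.
  by split; apply/imfsetP; exists (i, j).
have h1 := infsum_exchange_half (ltW e0) (null_family_row F0)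
  (null_family_sum F0) Fe.
have h2 := infsum_exchange_half (ltW e0) (@null_family_row _ _ (fun j => F^~ j) F0')
  (@null_family_sum _ _ (fun j => F^~ j) F0')
  (fun j i => fun ji => Fe i j (etrans (orbC _ _) ji)).
rewrite exchange_big/= nanormDist in h2.
by have := nanormD_le h1 h2; rewrite subrKA.
Qed.

End Summation.

Section LaurentSeries.
Context (R : realType) (K : completeNonarchFieldType R) (n : nat).
Context (rho : 'I_n -> {posnum R}).
Implicit Types (f g h : 'rV[int]_n -> K) (i j k : 'rV[int]_n).

Definition multi_norm i : nat := (\sum_(k < n) `|i 0%R k|)%N.

Definition radius_exp i : R := \prod_(k < n) (rho k)%:num ^ i 0 k.

Definition decaying f : Prop := forall e : R, 0 < e ->
  exists N, forall i, (N <= multi_norm i)%N -> nanorm (f i) * radius_exp i < e.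

Lemma radius_exp_gt0 i : 0 < radius_exp i.
Proof. by apply: prodr_gt0 => k _; rewrite exprz_gt0. Qed.

Lemma radius_expD i j : radius_exp (i + j) = radius_exp i * radius_exp j.
Proof.
rewrite /radius_exp -big_split/=; apply: eq_bigr => k _.
by rewrite mxE expfzDr// gt_eqF.
Qed.

Lemma radius_expB i k : radius_exp i * radius_exp (k - i) = radius_exp k.
Proof. by rewrite -radius_expD addrC subrK. Qed.

Lemma multi_normD i j : (multi_norm (i + j) <= multi_norm i + multi_norm j)%N.
Proof.
rewrite /multi_norm -big_split/=; apply: leq_sum => k _; rewrite mxE.
by have := leqD_dist (i 0 k) 0 (- j 0 k); rewrite subr0 sub0r !opprK.
Qed.

Lemma multi_norm_finite N : exists A : {fset 'rV[int]_n},
  forall i, (multi_norm i < N)%N -> i \in A.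
Proof.
pose dec (f : {ffun 'I_n -> 'I_N * bool}) : 'rV[int]_n :=
  \row_k (if (f k).2 then - (val (f k).1)%:Z else (val (f k).1)%:Z).
exists [fset dec f | f in {ffun 'I_n -> 'I_N * bool}]%fset => i iN.
have ik (k : 'I_n) : (`|i ord0 k| < N)%N.
  by apply: leq_ltn_trans iN; rewrite /multi_norm (bigD1 k)//= leq_addr.
apply/imfsetP; exists [ffun k => (Ordinal (ik k), i ord0 k < 0)] => //.
apply/rowP => k; rewrite mxE ffunE /= -[ord0]/(0 : 'I_1).
case: ltP => ik0; first by rewrite ltz0_abs// opprK.
by rewrite gez0_abs.
Qed.

Definition wnorm f i : R := nanorm (f i) * radius_exp i.

Lemma wnorm_ge0 f i : 0 <= wnorm f i.
Proof. by rewrite mulr_ge0 ?nanorm_ge0// ltW// radius_exp_gt0. Qed.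

Lemma wnormM f g i k :
  nanorm (f i * g (k - i)) * radius_exp k = wnorm f i * wnorm g (k - i).
Proof. by rewrite nanormM -(radius_expB i k) mulrACA. Qed.

Lemma decaying_cofinite f : decaying f -> forall e : R, 0 < e ->
  exists A : {fset 'rV[int]_n}, forall i, i \notin A -> wnorm f i <= e.
Proof.
move=> df e /df[N hN]; have [A hA] := multi_norm_finite N.
exists A => i iA; apply/ltW/hN; rewrite leqNgt.
by apply: contraNN iA; exact: hA.
Qed.

Lemma decaying_bounded f : decaying f ->
  exists2 C : R, 0 < C & forall i, wnorm f i <= C.
Proof.
move=> /decaying_cofinite/(_ 1 ltr01)[A hA].
exists (1 + \sum_(i <- A) wnorm f i) => [|i].
  by rewrite ltr_pwDl// sumr_ge0// => i _; exact: wnorm_ge0.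
have [iA|/hA fi] := boolP (i \in A); last first.
  by rewrite (le_trans fi)// lerDl sumr_ge0// => j _; exact: wnorm_ge0.
rewrite (big_fsetD1 i)//= addrCA lerDl addr_ge0// sumr_ge0// => j _.
exact: wnorm_ge0.
Qed.

(* The coefficients of a product are convolutions over all of Z^n, hence        *)
(* infinite sums.                                                              *)
Definition laurent_mul f g : 'rV[int]_n -> K :=
  fun k => infsum (fun i => f i * g (k - i)).

Definition laurent_one : 'rV[int]_n -> K := fun i => (i == 0)%:R.

Lemma decaying0 : decaying 0.
Proof. by move=> e e0; exists 0%N => i _; rewrite nanorm0 mul0r. Qed.

Lemma decayingB f g : decaying f -> decaying g -> decaying (f - g).
Proof.
move=> df dg e e0; have [N hN] := df e e0; have [M hM] := dg e e0.
exists (maxn N M) => i; rewrite geq_max => /andP[/hN + /hM].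
rewrite -!ltr_pdivlMr ?radius_exp_gt0// => hf hg.
by apply: nanormD_lt => //; rewrite nanormN.
Qed.

Lemma decaying1 : decaying laurent_one.
Proof.
move=> e e0; exists 1%N => i i1; rewrite /laurent_one.
have [i0|_] := eqVneq i 0; last by rewrite nanorm0 mul0r.
by move: i1; rewrite i0 /multi_norm big1// => k _; rewrite mxE.
Qed.

Lemma null_mul f g k : decaying f -> decaying g ->
  null_family (fun i => f i * g (k - i)).
Proof.
move=> df dg e e0; have [C C0 gC] := decaying_bounded dg.
have rk := radius_exp_gt0 k.
have [A hA] := decaying_cofinite df (divr_gt0 (mulr_gt0 e0 rk) C0).
exists A => i /hA fi; rewrite -(ler_pM2r rk) wnormM.
rewrite -[leRHS](divfK (lt0r_neq0 C0)).
by apply: ler_pM; rewrite ?wnorm_ge0.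
Qed.

Lemma decayingM f g : decaying f -> decaying g -> decaying (laurent_mul f g).
Proof.
move=> df dg e e0; have [C C0 fC] := decaying_bounded df.
have [D D0 gD] := decaying_bounded dg.
have e2 : 0 < e / 2 by rewrite divr_gt0.
have [N hN] := df _ (divr_gt0 e2 D0); have [M hM] := dg _ (divr_gt0 e2 C0).
exists (N + M)%N => k kNM; have rk := radius_exp_gt0 k.
apply: (@le_lt_trans _ _ (e / 2)); last by lra.
rewrite -ler_pdivlMr//; apply: infsum_le.
- by rewrite divr_ge0// ltW.
- exact: null_mul.
move=> i; rewrite ler_pdivlMr// wnormM.
have [Ni|iN] := leqP N (multi_norm i).
  rewrite -[leRHS](divfK (lt0r_neq0 D0)).
  by apply: ler_pM; rewrite ?wnorm_ge0// ltW// hN.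
rewrite mulrC -[leRHS](divfK (lt0r_neq0 C0)).
apply: ler_pM; rewrite ?wnorm_ge0// ltW// hM//.
rewrite leqNgt; apply/negP => Mi; move: kNM; rewrite leqNgt => /negP; apply.
rewrite -{1}(subrK i k); apply: (leq_ltn_trans (multi_normD _ _)).
by rewrite addnC -addSn leq_add// ltnW.
Qed.

Lemma laurent_mulC f g : decaying f -> decaying g ->
  laurent_mul f g = laurent_mul g f.
Proof.
move=> df dg; apply/funext => k; apply: has_sumE.
have kK : cancel (fun i => k - i) (fun i => k - i) by move=> i; rewrite subKr.
have /(has_sum_reindex kK kK) := null_has_sum (null_mul k dg df).
congr has_sum; apply/funext => i /=.
by rewrite subKr mulrC.
Qed.

Lemma laurent_mul1 f : laurent_mul laurent_one f = f.
Proof.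
apply/funext => k; apply: has_sumE.
have := @has_sum_fin _ _ _ (fun i => laurent_one i * f (k - i)) [fset 0]%fset.
rewrite big_seq_fset1 /laurent_one eqxx mul1r subr0; apply => i.
by rewrite inE => /negbTE ->; rewrite mul0r.
Qed.

Lemma laurent_mulDl f g h : decaying f -> decaying g -> decaying h ->
  laurent_mul (f + g) h = laurent_mul f h + laurent_mul g h.
Proof.
move=> df dg dh; apply/funext => k; apply: has_sumE.
have := has_sumD (null_has_sum (null_mul k df dh)) (null_has_sum (null_mul k dg dh)).
congr has_sum; apply/funext => i.
by rewrite -mulrDl.
Qed.

Lemma laurent_mulA f g h : decaying f -> decaying g -> decaying h ->
  laurent_mul f (laurent_mul g h) = laurent_mul (laurent_mul f g) h.
Proof.
move=> df dg dh; apply/funext => k.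
pose F j i : K := f j * (g (i - j) * h (k - i)).
have dgh := decayingM dg dh; have dfg := decayingM df dg.
have lhs : laurent_mul f (laurent_mul g h) k = infsum (fun j => infsum (F j)).
  congr infsum; apply/funext => j; rewrite infsumMl; last exact: null_mul.
  symmetry; apply: has_sumE.
  have jK : cancel (fun i => i - j) (fun i => i + j) by move=> i; rewrite subrK.
  have jK' : cancel (fun i => i + j) (fun i => i - j) by move=> i; rewrite addrK.
  have := null_has_sum (null_mul (k - j) dg dh) => /(has_sumMl (f j)).
  move=> sm; rewrite (has_sumE sm).
  move/(has_sum_reindex jK jK') : sm; congr has_sum; apply/funext => i /=.
  by rewrite /F opprB addrA subrK.
have rhs : laurent_mul (laurent_mul f g) h k =
    infsum (fun i => infsum (F^~ i)).
  congr infsum; apply/funext => i; rewrite mulrC infsumMl; last exact: null_mul.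
  by congr infsum; apply/funext => j; rewrite /F mulrC mulrA.
rewrite lhs rhs; apply: infsum_exchange => e e0.
have [C C0 fC] := decaying_bounded df; have [D D0 gD] := decaying_bounded dg.
have [E E0 hE] := decaying_bounded dh; have rk := radius_exp_gt0 k.
have [A hA] := decaying_cofinite df
  (divr_gt0 (mulr_gt0 e0 rk) (mulr_gt0 D0 E0)).
have [B hB] := decaying_cofinite dh
  (divr_gt0 (mulr_gt0 e0 rk) (mulr_gt0 C0 D0)).
exists [fset (j, k - l) | j in A, l in B]%fset => -[j i] ji /=.
rewrite -(ler_pM2r rk) /F.
have -> : nanorm (f j * (g (i - j) * h (k - i))) * radius_exp k =
    wnorm f j * (wnorm g (i - j) * wnorm h (k - i)).
  rewrite !nanormM /wnorm -(radius_expB i k) -(radius_expB j i).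
  by ring.
have [jA|jA] := boolP (j \in A); last first.
  rewrite -[leRHS](divfK (lt0r_neq0 (mulr_gt0 D0 E0))).
  apply: ler_pM; [exact: wnorm_ge0|by rewrite mulr_ge0 ?wnorm_ge0|exact: hA|].
  by apply: ler_pM; rewrite ?wnorm_ge0.
rewrite mulrA mulrC -[leRHS](divfK (lt0r_neq0 (mulr_gt0 C0 D0))).
apply: ler_pM; [exact: wnorm_ge0|by rewrite mulr_ge0 ?wnorm_ge0| |]; last first.
  by apply: ler_pM; rewrite ?wnorm_ge0.
apply: hB; apply: contraNN ji => iB; apply/imfset2P.
by exists j => //; exists (k - i) => //; rewrite subKr.
Qed.

End LaurentSeries.

Section LaurentRing.
Context (R : realType) (K : completeNonarchFieldType R) (n : nat).
Context (rho : 'I_n -> {posnum R}).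

Definition decaying_pred : {pred 'rV[int]_n -> K} :=
  [pred f | `[< decaying rho f >]].

Lemma decaying_zmod_closed : zmod_closed decaying_pred.
Proof.
split=> [|f g]; first by apply/asboolP; exact: decaying0.
by move=> /asboolP df /asboolP dg; apply/asboolP; exact: decayingB.
Qed.

HB.instance Definition _ :=
  GRing.isZmodClosed.Build ('rV[int]_n -> K) decaying_pred decaying_zmod_closed.

Record laurent : Type := Laurent {
  lcoef :> 'rV[int]_n -> K;
  lcoef_decaying_pred : lcoef \in decaying_pred
}.

HB.instance Definition _ := [isSub for lcoef].
HB.instance Definition _ := [Choice of laurent by <:].
HB.instance Definition _ := [SubChoice_isSubZmodule of laurent by <:].

Lemma lcoef_decaying (f : laurent) : decaying rho f.
Proof. exact/asboolP/lcoef_decaying_pred. Qed.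

Definition lone : laurent := Laurent (asboolT (decaying1 K rho)).

Definition lmul (f g : laurent) : laurent :=
  Laurent (asboolT (decayingM (lcoef_decaying f) (lcoef_decaying g))).

Fact lmulA : associative lmul.
Proof.
by move=> f g h; apply/val_inj/(laurent_mulA (rho := rho));
  exact: lcoef_decaying.
Qed.

Fact lmulC : commutative lmul.
Proof.
by move=> f g; apply/val_inj/(laurent_mulC (rho := rho));
  exact: lcoef_decaying.
Qed.

Fact lmul1 : left_id lone lmul.
Proof. by move=> f; apply/val_inj/laurent_mul1. Qed.

Fact lmulDl : left_distributive lmul +%R.
Proof.
by move=> f g h; apply/val_inj/(laurent_mulDl (rho := rho));
  exact: lcoef_decaying.
Qed.

Fact lone_neq0 : lone != 0.
Proof.
apply/eqP => /(congr1 (fun f : laurent => f 0))/eqP.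
by rewrite /= /laurent_one eqxx oner_eq0.
Qed.

HB.instance Definition _ := GRing.Zmodule_isComNzRing.Build laurent
  lmulA lmulC lmul1 lmulDl lone_neq0.

End LaurentRing.

Arguments laurent {R} K {n} rho.

Section Modules.
Context (A : comNzRingType) (M : lmodType A).

Definition finitely_generated : Prop :=
  exists S : {fset M}, forall x, exists c : M -> A, x = \sum_(y <- S) c y *: y.

Definition projective : Prop :=
  forall (N N' : lmodType A) (g : {linear N -> N'}) (f : {linear M -> N'}),
    (forall y, exists x, g x = y) ->
    exists h : {linear M -> N}, forall x, g (h x) = f x.

Definition linearly_independent (B : set M) : Prop :=
  forall (S : {fset M}) (c : M -> A), (forall y, y \in S -> B y) ->
    \sum_(y <- S) c y *: y = 0 -> forall y, y \in S -> c y = 0.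

Definition spanning (B : set M) : Prop :=
  forall x, exists (S : {fset M}) (c : M -> A),
    (forall y, y \in S -> B y) /\ x = \sum_(y <- S) c y *: y.

Definition free_module : Prop :=
  exists B : set M, linearly_independent B /\ spanning B.

End Modules.

(* Main.v *)
Require Import Defs.
From HB Require Import structures.
From mathcomp Require Import all_boot all_order all_algebra finmap.
From mathcomp Require Import perm boolp classical_sets functions.
From mathcomp Require Import reals interval_inference.
From mathcomp Require Import ring lra zify.

(** Write A for the ring of Laurent series and call d in A a Weierstrass divisor
    when d is, up to a unit, a monic polynomial w with unit constant term in
    some variable x over some subring R, such that division by w with remainder
    holds in A exactly as in R[x], that is, A/(w) = R[x]/(w). The theorem
    combines one analytic fact with commutative algebra.

    The analytic fact is that every d <> 0 in A is a Weierstrass divisor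
    ([laurent_weierstrass_divisor]). Only finitely many terms of d attain its
    Gauss norm. Some linear form phi on Z^n separates their exponents and takes
    the value 1 ([separating_form]). Let R be the ring of series supported on
    the kernel of phi and x a monomial of phi-degree 1. As a series in x over R,
    d has finitely many coefficients of maximal norm, and each of them has a
    single dominant term, so it is a unit of R. The lowest and the highest of
    them allow division by d: exponents above the window are lowered with the
    highest one, exponents below it are raised with the lowest one, and
    successive approximation takes care of the small terms
    ([weierstrass_division]).

    Unimodular rows over A can be completed to invertible matrices. Such a row
    has a nonzero entry, which may be taken to be a monic polynomial w; reducing
    the other entries modulo w makes all of them polynomials over R, and the row
    remains unimodular over R[x] because A/(w) = R[x]/(w). By Suslin's theorem
    ([suslin]) it is equivalent to its value at x = 0, which has a unit entry.
    Hence stably free modules over A are free ([unimodular_mx_completion]).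

    Finally, finite projective modules P over A are stably free. Over the
    fraction field P becomes free, so there is d <> 0, which may be taken to be
    a monic w, with w A^r inside P inside A^r ([idempotent_factorization]).
    Division by w yields an R-linear projection of A^r with kernel P
    ([quotient_coordinates]), so that Q = A^r / P, which is killed by w, is a
    finite projective R-module. Multiplication by x on Q is thus given by a
    matrix T over R, and x - T resolves Q over A. Comparing this resolution
    with A^r -> Q exhibits P as the kernel of a surjection from A^(m + r) to
    A^m ([pencil_presentation]), so P is free ([idempotent_free]). *)

Set Implicit Arguments.
Unset Strict Implicit.
Unset Printing Implicit Defensive.

Import Order.TTheory GRing.Theory Num.Theory.
Local Open Scope classical_set_scope.
Local Open Scope ring_scope.

(** * Residue fields *)

Section ResidueField.
Context (R : comNzRingType).

Definition is_ideal (J : set R) : Prop :=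
  [/\ J 0, forall a b, J a -> J b -> J (a + b) & forall a b, J b -> J (a * b)].

Section MaximalQuotient.
Context (m : set R) (m_ideal : is_ideal m) (m1 : ~ m 1).
Hypothesis m_max : forall x, ~ m x -> exists a, m (a * x - 1).

Definition ideal_pred : {pred R} := [pred x | `[< m x >]].

Lemma ideal_pred_closed : idealr_closed ideal_pred.
Proof.
have [m0 mD mM] := m_ideal; split; first exact/asboolP.
  by apply/negP => /asboolP.
move=> a u v /asboolP mu /asboolP mv; apply/asboolP; apply: mD => //.
exact: mM.
Qed.

HB.instance Definition _ := isIdealr.Build R ideal_pred ideal_pred_closed.

Local Notation Q := {ideal_quot ideal_pred}.
Local Notation residue := (\pi_Q%qT : R -> Q).

Lemma residue_eq0 x : (residue x == 0) = `[< m x >].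
Proof.
rewrite -[0 in LHS](rmorph0 residue).
by rewrite -Quotient.idealrBE subr0.
Qed.

Lemma residue_inverse (y : Q) : exists z : Q, y != 0 -> z * y = 1.
Proof.
elim/quotW: y => x; have [mx|/m_max[a ma]] := pselect (m x).
  by exists 0; rewrite residue_eq0 asboolT.
exists (residue a) => _; apply/eqP; rewrite -subr_eq0.
by rewrite -rmorphM -(rmorph1 residue) -rmorphB residue_eq0; apply/asboolP.
Qed.

Lemma maximal_quotient : exists (k : fieldType) (f : {rmorphism R -> k}),
  (forall y, exists x, f x = y) /\ forall x, m x -> f x = 0.
Proof.
have [inv invP] := choice residue_inverse.
pose inv' (y : Q) := if y == 0 then 0 else inv y.
have inv'V y : y != 0 -> inv' y * y = 1.
  by move=> y0; rewrite /inv' (negbTE y0) invP.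
have inv'0 : inv' 0 = 0 by rewrite /inv' eqxx.
pose k : fieldType := HB.pack Q (GRing.ComNzRing_isField.Build Q inv'V inv'0).
exists k, (residue : {rmorphism R -> Q}); split.
  by elim/quotW => x; exists x.
by move=> x mx; apply/eqP; rewrite [_ == _]residue_eq0; apply/asboolP.
Qed.

End MaximalQuotient.

(** The sets X for which J together with X is a proper ideal form the poset
    to which Zorn's lemma applies: this choice keeps the union of the empty chain in the
    poset. *)
Lemma residue_field (J : set R) : is_ideal J -> ~ J 1 ->
  exists (k : fieldType) (f : {rmorphism R -> k}),
    (forall y, exists x, f x = y) /\ forall x, J x -> f x = 0.
Proof.
move=> Jideal J1; have [J0 JD JM] := Jideal.
pose P X := is_ideal (J `|` X) /\ ~ X 1.
have [|A [[Aideal A1] Amax]] := @Zorn_bigcup _ P.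
  move=> F FP totF; split; last by case=> X /FP[_].
  split=> [|a b|a b]; [by left| |].
  - have inX X x y : F X -> (J `|` X) x -> (J `|` X) y ->
        (J `|` \bigcup_(Y in F) Y) (x + y).
      move=> FX Xx Xy; have [[_ XD _] _] := FP _ FX.
      by case: (XD _ _ Xx Xy) => [|h]; [left|right; exists X].
    move=> [Ja|[X FX Xa]] [Jb|[Y FY Yb]]; first by left; exact: JD.
    + by apply: (inX Y) => //; [left|right].
    + by apply: (inX X) => //; [right|left].
    + by have [XY|YX] := totF _ _ FX FY; [apply: (inX Y)|apply: (inX X)] => //;
        right => //; [exact: XY|exact: YX].
  - case=> [Jb|[X FX Xb]]; first by left; exact: JM.
    have [[_ _ XM] _] := FP _ FX.
    by case: (XM a b (or_intror Xb)) => [|h]; [left|right; exists X].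
pose m := J `|` A.
have m1 : ~ m 1 by case.
have [k [f [fsurj fm]]] : exists (k : fieldType) (f : {rmorphism R -> k}),
    (forall y, exists x, f x = y) /\ forall x, m x -> f x = 0.
  apply: maximal_quotient => // x mx; have [m0 mD mM] := Aideal.
  pose B := [set y | exists a, m (y - a * x)].
  have mN a : m a -> m (- a) by rewrite -mulN1r; exact: mM.
  have mB y : m y -> B y by exists 0; rewrite mul0r subr0.
  have [[a ma]|B1] := pselect (B 1).
    by exists a; rewrite -opprB; exact: mN.
  exfalso; apply: (Amax B).
    split=> [|BA]; first by move=> y Ay; apply: mB; right.
    by apply: mx; right; apply: BA; exists 1; rewrite mul1r subrr.
  split=> //.
  have -> : J `|` B = B.
    by apply/seteqP; split=> y; [case=> // Jy; apply: mB; left|right].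
  split=> [|y z [a ya] [b zb]|y z [b zb]]; first exact: mB.
  - exists (a + b).
    have -> : y + z - (a + b) * x = (y - a * x) + (z - b * x) by ring.
    exact: mD.
  - exists (y * b).
    have -> : y * z - y * b * x = y * (z - b * x) by ring.
    exact: mM.
by exists k, f; split=> // x Jx; apply: fm; left.
Qed.

End ResidueField.

(** * Suslin's theorem on unimodular rows of polynomials *)

Section StableRange.
Context (k : fieldType).
Implicit Types p q r s : {poly k}.

(** The quotient k[X]/(p) is a finite product of local rings, so s only has to be
    added at the prime factors of p that divide q. The largest divisor of p
    coprime to q vanishes at exactly the other ones. *)
Lemma stable_range_one p q s : p != 0 ->
  (exists u v w, u * p + v * q + w * s = 1) ->
  exists h, coprimep p (q + h * s).
Proof.
move=> p0 [u [v [w uvw]]]; exists (gdcop q p).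
case: gdcopP => r rp; rewrite (negbTE p0) orbF => rq rmax.
set t := q + r * s; rewrite /coprimep.
suff gq : coprimep (gcdp p t) q.
  have gr : gcdp p t %| r by apply: rmax => //; exact: dvdp_gcdl.
  have : gcdp p t %| q.
    have := dvdp_gcdr p t; rewrite {2}/t => gt.
    by rewrite -(dvdp_addl q (dvdp_mulr s gr)).
  by move=> gdq; move: (coprimep_dvdl gdq gq); rewrite coprimepp.
have dg := dvdp_gcdl (gcdp p t) q; have dq := dvdp_gcdr (gcdp p t) q.
rewrite /coprimep; set d := gcdp (gcdp p t) q in dg dq *.
have dp : d %| p by exact: dvdp_trans dg (dvdp_gcdl _ _).
have drs : d %| r * s.
  rewrite -(dvdp_addr _ dq); exact: dvdp_trans dg (dvdp_gcdr _ _).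
have ds : d %| s.
  rewrite -(@Gauss_dvdpr _ s r d)//.
  by apply: coprimep_dvdr dq _; rewrite coprimep_sym.
have : d %| 1 by rewrite -uvw !dvdp_add ?dvdp_mull.
by rewrite dvdp1.
Qed.
End StableRange.

Lemma map_poly_resultant (aR rR : nzRingType) (f : {rmorphism aR -> rR})
    (p q : {poly aR}) : f (lead_coef p) != 0 -> f (lead_coef q) != 0 ->
  f (resultant p q) = resultant (map_poly f p) (map_poly f q).
Proof.
move=> fp fq; rewrite /resultant /Sylvester_mx !size_map_poly_id0//.
rewrite -det_map_mx/= map_col_mx; congr (\det (col_mx _ _));
  by apply: map_lin1_mx => v; rewrite map_poly_rV rmorphM/= map_rVpoly.
Qed.

Section Elimination.
Context (R : idomainType) (k : fieldType) (f : {rmorphism R -> k}).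
Hypothesis f_surj : forall y, exists x, f x = y.
Local Notation "p ^f" := (map_poly f p).

Lemma map_poly_surj (q : {poly k}) : exists p : {poly R}, p^f = q.
Proof.
have [g fg] := choice f_surj; exists (map_poly (fun y => if y == 0 then 0 else g y) q).
apply/polyP => i; rewrite coef_map coef_map_id0 ?eqxx//=.
by case: eqP => [->|_]; rewrite ?rmorph0 ?fg.
Qed.

(** The constant is a resultant. That of p and q may be killed by f, since the
    degree of q can drop under f; so q is replaced by a monic polynomial h in the
    ideal of p and q whose image under f is 1 modulo the image of p. *)
Lemma monic_elimination (p q : {poly R}) : p \is monic -> coprimep p^f q^f ->
  exists c, f c != 0 /\ exists u v, c%:P = u * p + v * q.
Proof.
move=> pm /Bezout_eq1_coprimepP[[u0 v0]/= uv0].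
have [u fu] := map_poly_surj u0; have [v fv] := map_poly_surj v0.
have p0 := monic_neq0 pm.
have [p1|p1] := leqP (size p) 1.
  exists 1; split; first by rewrite rmorph1 oner_neq0.
  exists 1, 0; rewrite mul0r addr0 mul1r [RHS](size1_polyC p1); congr _%:P.
  move: (monicP pm); rewrite lead_coefE; case: (size p) p1 => [|[|]]//= _ ->.
set t := u * p + v * q.
have ft : t^f = 1 by rewrite !rmorphD/= !rmorphM/= fu fv.
(* the power of X makes the multiple of p dominate t, so h is monic *)
pose h := t + 'X^(size t) * p.
have szt : (size t < size ('X^(size t) * p)%R)%N.
  rewrite mulrC size_Mmonic ?monicXn// size_polyXn addnS/= addnC.
  by rewrite -[X in (X < _)%N]addn0 ltn_add2l ltnW.
have hm : h \is monic.
  by rewrite monicE lead_coefDr// lead_coef_Mmonic ?monicXn// -monicE monicXn.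
have hs : (1 < size h)%N.
  rewrite /h addrC size_polyDl// mulrC size_Mmonic ?monicXn//.
  by rewrite size_polyXn addnS/= (leq_trans p1)// leq_addr.
exists (resultant p h); split; last first.
  have [[a b] _ ->/=] := resultant_in_ideal p1 hs.
  exists (a + b * u + b * 'X^(size t)), (b * v); rewrite /h /t; ring.
rewrite map_poly_resultant; try by rewrite (monicP _) // rmorph1 oner_neq0.
rewrite resultant_eq0 -leqNgt.
suff /eqP -> : coprimep p^f h^f by [].
apply/Bezout_eq1_coprimepP; exists (- ('X^(size t))^f, 1) => /=.
by rewrite [h^f]rmorphD/= ft [X in 1 + X]rmorphM/=; ring.
Qed.
End Elimination.

Section Suslin.
Context (R : idomainType).
Implicit Types (p q b y : {poly R}) (c : R).

Lemma comp_poly_shift p b c y :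
  exists z, p \Po (b + c%:P * y) = p \Po b + c%:P * z.
Proof.
elim/poly_ind: p => [|p a [z pz]]; first by exists 0; rewrite !comp_poly0; ring.
exists (z * (b + c%:P * y) + (p \Po b) * y).
by rewrite !comp_polyD !comp_polyM !comp_polyX !comp_polyC pz; ring.
Qed.

Lemma comp_mx_shift m n (M : 'M[{poly R}]_(m, n)) b c y : exists Z,
  map_mx (comp_poly (b + c%:P * y)) M = map_mx (comp_poly b) M + c%:P *: Z.
Proof.
have [z zP] := choice (fun ij : 'I_m * 'I_n => comp_poly_shift (M ij.1 ij.2) b c y).
exists (\matrix_(i, j) z (i, j)); apply/matrixP => i j.
by rewrite !mxE (zP (i, j)).
Qed.

(** This is the step that moves the variable: writing M(b + c y) = M(b) + c Z and
    using adj(M(b)) M(b) = c, the matrix B = 1 + adj(M(b)) Z is the quotient of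
    M(b + c y) by M(b), with no denominator left. *)
Lemma completed_shift n (M : 'M[{poly R}]_n) b c y : c != 0 -> \det M = c%:P ->
  exists2 B, B \in unitmx &
    map_mx (comp_poly b) M *m B = map_mx (comp_poly (b + c%:P * y)) M.
Proof.
move=> c0 detM; have [Z MZ] := comp_mx_shift M b c y.
have det_comp b' : \det (map_mx (comp_poly b') M) = c%:P.
  by rewrite det_map_mx detM/= comp_polyC.
exists (1%:M + \adj (map_mx (comp_poly b) M) *m Z); last first.
  by rewrite mulmxDr mulmx1 mulmxA mul_mx_adj det_comp mul_scalar_mx MZ.
suff dB : \det (1%:M + \adj (map_mx (comp_poly b) M) *m Z) = 1.
  by rewrite unitmxE dB unitr1.
have cP0 : c%:P != 0 by rewrite polyC_eq0.
apply: (mulfI cP0); rewrite -{1}(det_comp b) -det_mulmx mulmxDr mulmx1 mulmxA.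
by rewrite mul_mx_adj det_comp mul_scalar_mx -MZ det_comp mulr1.
Qed.

Lemma det_block_scalar (A : comPzRingType) (a b c d : A) :
  \det (block_mx a%:M b%:M c%:M d%:M : 'M_(1 + 1)) = a * d - b * c.
Proof.
have det2 (B : 'M[A]_(1 + 1)) : \det B =
    B (lshift 1 0) (lshift 1 0) * B (rshift 1 0) (rshift 1 0) -
    B (lshift 1 0) (rshift 1 0) * B (rshift 1 0) (lshift 1 0).
  rewrite (expand_det_row _ 0) !big_ord_recl big_ord0 addr0 /cofactor !det_mx11.
  rewrite !mxE.
  rewrite expr0 expr1 mul1r mulN1r mulrN.
  by congr (B _ _ * B _ _ - B _ _ * B _ _); apply/val_inj.
by rewrite det2 block_mxEul block_mxEur block_mxEdl block_mxEdr !mxE eqxx !mulr1n.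
Qed.

(** The completion up to c: modulo the ideal cut out by f, the entry q can be
    changed by a multiple of the remaining entries into one coprime to p, and
    then two entries alone generate a constant c outside the ideal. *)
Lemma completion_det n (k : fieldType) (f : {rmorphism R -> k}) (p q y0 y1 : {poly R})
    (z : 'rV[{poly R}]_n) (w : 'cV_n) :
  (forall x, exists a, f a = x) ->
  p \is monic -> y0 * p + y1 * q + (z *m w) 0 0 = 1 ->
  exists2 M : 'M[{poly R}]_(1 + 1 + n), exists2 c, f c != 0 & \det M = c%:P &
    usubmx (usubmx M) = row_mx (row_mx p%:M q%:M) z.
Proof.
move=> f_surj pm yz; set s := (z *m w) 0 0 in yz.
have p0 : map_poly f p != 0 by rewrite monic_neq0// monic_map.
have [|h0 ph] := @stable_range_one _ _ (map_poly f q) (map_poly f s) p0.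
  exists (map_poly f y0), (map_poly f y1), 1.
  by rewrite mul1r -!rmorphM -!rmorphD/= yz rmorph1.
have [h fh] := map_poly_surj f_surj h0.
have [|c [fc [u [v uv]]]] := monic_elimination (q := q + h * s) f_surj pm.
  by rewrite rmorphD rmorphM/= fh.
pose D := block_mx p%:M (q + h * s)%:M (- v)%:M u%:M : 'M_(1 + 1).
pose M1 := block_mx D (col_mx z 0) 0 1%:M.
(* L undoes the column operation that turned q into q + h s *)
pose L := block_mx 1%:M 0 (row_mx 0 (- h *: w)) 1%:M : 'M_(1 + 1 + n).
exists (M1 *m L).
  exists c => //; rewrite det_mulmx det_ublock det_lblock !det1 !mulr1.
  by rewrite det_block_scalar uv; ring.
rewrite /M1 /L mulmx_block !mulmx1 mulmx0 add0r.
rewrite mul_col_row mul0mx /D add_block_mx mulmx0 -scalemxAr mul0mx !addr0.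
rewrite block_mxEv col_mxKu block_mxEv -block_mxEh.
rewrite block_mxEv col_mxKu; congr (row_mx (row_mx _ _) _).
rewrite [z *m w]mx11_scalar -/s scale_scalar_mx -raddfD/=; congr _%:M; ring.
Qed.

(** The constants c such that translating the variable by multiples of c does not
    change the class of the row form an ideal J. If J were proper, a residue
    field of R killing J would contradict [completion_det]; so 1 is in J and X
    can be translated to 0. *)
Theorem suslin n (p q y0 y1 : {poly R}) (z : 'rV[{poly R}]_n) (w : 'cV_n) :
  p \is monic -> y0 * p + y1 * q + (z *m w) 0 0 = 1 ->
  let f := row_mx (row_mx p%:M q%:M) z : 'rV_(1 + 1 + n) in
  exists2 G, G \in unitmx & f *m G = map_mx (comp_poly 0) f.
Proof.
move=> pm yz f.
pose J := [set c : R | forall b y, exists2 G, G \in unitmx &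
  map_mx (comp_poly b) f *m G = map_mx (comp_poly (b + c%:P * y)) f].
have Jid : is_ideal J.
  split=> [b y|c d Jc Jd b y|c d Jd b y].
  - by exists 1%:M; rewrite ?unitmx1// mulmx1 mul0r addr0.
  - have [G Gu fG] := Jc b y; have [H Hu fH] := Jd (b + c%:P * y) y.
    exists (G *m H); first by rewrite unitmx_mul Gu.
    by rewrite mulmxA fG fH -addrA -mulrDl -rmorphD.
  - have [G Gu fG] := Jd b (c%:P * y); exists G => //.
    by rewrite fG rmorphM/= mulrA [d%:P * _]mulrC.
have J1 : J 1.
  apply: contrapT => /(residue_field Jid)[k [g [gsurj gJ]]].
  have [M [c gc detM] fM] := completion_det gsurj pm yz.
  have c0 : c != 0 by apply: contraNneq gc => ->; rewrite rmorph0.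
  case/eqP: gc; apply: gJ => b y.
  have [B Bu MB] := completed_shift b y c0 detM; exists B => //.
  by rewrite /f -fM !map_usubmx -MB -!mul_usub_mx.
have [G Gu fG] := J1 'X (- 'X); exists G => //.
have fX : map_mx (comp_poly 'X) f = f.
  by apply/matrixP => i j; rewrite mxE comp_polyXr.
by rewrite -[in LHS]fX fG mul1r subrr.
Qed.
End Suslin.

(** * Completion of unimodular rows and matrices *)

(** The last two clauses say that w is regular in A and that the classes of
    1, X, .., X^(deg w - 1) form a basis of A/(d) over R. *)
Definition weierstrass_divisor (A : idomainType) (d : A) : Prop :=
  exists (R : idomainType) (ev : {rmorphism {poly R} -> A}) (w : {poly R}),
  [/\ w \is monic, w`_0 \is a GRing.unit,
      exists2 u, u \is a GRing.unit & ev w = d * u,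
      forall f, exists q (r : {poly R}), (size r < size w)%N /\ f = q * ev w + ev r
    & forall q (r : {poly R}), (size r < size w)%N -> q * ev w + ev r = 0 ->
        q = 0 /\ r = 0].

Section Completion.
Context (A : idomainType).

Definition completable n (v : 'rV[A]_(1 + n)) : Prop :=
  exists2 G, G \in unitmx & v *m G = row_mx 1%:M 0.

Lemma completable_mulmx n (v : 'rV[A]_(1 + n)) H :
  H \in unitmx -> completable (v *m H) -> completable v.
Proof.
move=> Hu [G Gu vG]; exists (H *m G); first by rewrite unitmx_mul Hu.
by rewrite mulmxA.
Qed.

Lemma completable_unit n (a : A) (v : 'rV[A]_n) :
  a \is a GRing.unit -> completable (row_mx a%:M v).
Proof.
move=> au; exists (block_mx a^-1%:M (- a^-1 *: v) 0 1%:M).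
  by rewrite unitmxE det_ublock det1 mulr1 det_scalar1 unitrV.
rewrite mul_row_block mulmx0 addr0 mulmx1 mul_scalar_mx scale_scalar_mx divrr//.
by rewrite mul_scalar_mx scalerA mulrN divrr// scaleN1r addNr.
Qed.

(** Modulo the first entry the others may be replaced by polynomials. A relation
    b w + r s = 1 over A descends to R[X]: the remainder of r s - 1 by w has to
    vanish by uniqueness of the division in A. *)
Lemma completable_weierstrass n (d : A) (v : 'rV[A]_n) (x : 'cV[A]_(1 + n)) :
  weierstrass_divisor d -> row_mx d%:M v *m x = 1%:M ->
  completable (row_mx d%:M v).
Proof.
move=> [R [ev [w [wm w0 [u uu evw] div divU]]]] vx.
have div_mx m k (B : 'M[A]_(m, k)) : exists Q (S : 'M[{poly R}]_(m, k)),
    B = ev w *: Q + map_mx ev S.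
  have [q qP] := choice (fun ij : 'I_m * 'I_k => div (B ij.1 ij.2)).
  have [r rP] := choice qP; exists (\matrix_(i, j) q (i, j)), (\matrix_(i, j) r (i, j)).
  by apply/matrixP => i j; rewrite !mxE mulrC; case: (rP (i, j)).
have [Q [r vE]] := div_mx _ _ v.
pose G1 : 'M[A]_(1 + n) := block_mx u%:M (- u *: Q) 0 1%:M.
have G1u : G1 \in unitmx by rewrite unitmxE det_ublock det1 mulr1 det_scalar1.
have vG1 : row_mx d%:M v *m G1 = row_mx (ev w)%:M (map_mx ev r).
  rewrite mul_row_block mulmx0 addr0 mulmx1 !mul_scalar_mx scale_scalar_mx -evw.
  by rewrite scalerA mulrN -evw scaleNr vE addKr.
apply: (completable_mulmx G1u); rewrite vG1.
have {vx vG1} : row_mx (ev w)%:M (map_mx ev r) *m (invmx G1 *m x) = 1%:M.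
  by rewrite -vG1 mulmxA mulmxK.
rewrite -[invmx G1 *m x]vsubmxK; move: (usubmx _) (dsubmx _) => x1 x2.
rewrite mul_row_col mul_scalar_mx.
have [Q2 [s ->]] := div_mx _ _ x2 => /(congr1 (fun M : 'M_1 => M 0 0)).
rewrite mulmxDr -scalemxAr -map_mxM.
set t := r *m s.
rewrite !mxE eqxx mulr1n => rel.
have [b tb] : exists b, b * w + t 0 0 = 1.
  exists (- ((t 0 0 - 1) %/ w)).
  have := Pdiv.IdomainMonic.divp_eq wm (t 0 0 - 1).
  set q := _ %/ w; set m := _ %% w => tE.
  suff m0 : m = 0 by move/eqP: tE; rewrite m0 addr0 subr_eq => /eqP ->; ring.
  pose e := x1 0 0 + (map_mx ev r *m Q2) 0 0 + ev q.
  apply: (proj2 (divU e m _ _)).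
    by rewrite ltn_modpN0// monic_neq0.
  have evt : ev (t 0 0) - 1 = ev q * ev w + ev m.
    by rewrite -rmorphM -rmorphD/= -tE rmorphB rmorph1.
  apply/eqP; rewrite -[ev m](addKr (ev q * ev w)) -evt -rel /e; apply/eqP.
  by rewrite [(_ *m Q2) 0 0]mxE [t 0 0]mxE; ring.
case: n r s @t tb {v x Q vE G1 G1u x1 Q2 x2 rel} => [|n] r s t tb.
  apply: completable_unit; apply/unitrPr; exists (ev b).
  by rewrite -rmorphM mulrC -(rmorph1 ev) -tb /t thinmx0 mul0mx mxE addr0.
have [q [z rE]] : exists q (z : 'rV_n), r = row_mx q%:M z :> 'rV_(1 + n).
  by exists (lsubmx (r : 'rV_(1 + n)) 0 0), (rsubmx (r : 'rV_(1 + n)));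
    rewrite -mx11_scalar hsubmxK.
have [G Gu fG] : exists2 G, G \in unitmx &
    row_mx w%:M r *m G = map_mx (comp_poly 0) (row_mx w%:M r).
  have [|G Gu fG] := @suslin _ n w q b
    (usubmx (s : 'cV_(1 + n)) 0 0) z (dsubmx (s : 'cV_(1 + n))) wm.
    rewrite -addrA -tb; congr (_ + _); rewrite /t -[r *m s]/(@mulmx _ 1 (1 + n) 1 r s).
    rewrite -[s in RHS](@vsubmxK _ 1 n) rE.
    by rewrite mul_row_col mul_scalar_mx !mxE [q * _]mulrC.
  exists G => //; suff -> : row_mx w%:M r = row_mx (row_mx w%:M q%:M) z :> 'rV_(1 + 1 + n).
    exact: fG.
  have := @row_mxA _ 1 1 1 n w%:M q%:M z; rewrite /= castmx_id => <-.
  by rewrite rE.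
apply: (@completable_mulmx _ _ (map_mx ev G)).
  by rewrite unitmxE det_map_mx rmorph_unit.
rewrite -(map_scalar_mx ev) -map_row_mx -map_mxM fG !map_row_mx.
rewrite !map_scalar_mx/= comp_poly0r; apply: completable_unit.
by rewrite !rmorph_unit.
Qed.

Hypothesis A_weierstrass : forall d : A, d != 0 -> weierstrass_divisor d.

Lemma unimodular_row_completable n (v : 'rV[A]_(1 + n)) (x : 'cV_(1 + n)) :
  v *m x = 1%:M -> completable v.
Proof.
move=> vx; have [j vj] : exists j, v 0 j != 0.
  apply: contrapT => v0; suff v00 : v = 0.
    move/matrixP/(_ 0 0): vx; rewrite v00 mul0mx !mxE eqxx => /esym/eqP.
    by rewrite oner_eq0.
  apply/rowP => j; rewrite mxE; apply/eqP/negPn/negP => vj.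
  by apply: v0; exists j.
have Pu : tperm_mx j (0 : 'I_(1 + n)) \in @unitmx A (1 + n) by exact: unitmx_perm.
apply: (completable_mulmx Pu); rewrite -xcolE.
have {vx} : xcol j (0 : 'I_(1 + n)) v *m (invmx (tperm_mx j (0 : 'I_(1 + n))) *m x) = 1%:M.
  by rewrite xcolE mulmxA mulmxK.
have : xcol j (0 : 'I_(1 + n)) v 0 0 != 0 by rewrite mxE tpermR.
move: (xcol _ _ _) (_ *m x) => {vj Pu x}v x v0.
rewrite -(hsubmxK v) [lsubmx v]mx11_scalar; apply: completable_weierstrass.
apply: A_weierstrass; rewrite mxE; move: v0.
by have -> : lshift n (0 : 'I_1) = 0 :> 'I_(1 + n) by apply/val_inj.
Qed.

(** Induction on the number of rows: completing the first row splits off a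
    one-dimensional block, and the lower right block is again right
    invertible. *)
Theorem unimodular_mx_completion m r (M : 'M[A]_(m, m + r)) (S : 'M_(m + r, m)) :
  M *m S = 1%:M ->
  exists2 G, G \in unitmx & exists2 T, T \in unitmx & M *m G = row_mx T 0.
Proof.
elim: m M S => [|m IH] M S MS.
  exists 1%:M; rewrite ?unitmx1//; exists 1%:M; rewrite ?unitmx1//.
  by rewrite [LHS]flatmx0 [RHS]flatmx0.
pose N : 'M[A]_(1 + m, 1 + (m + r)) := M.
pose V : 'M[A]_(1 + (m + r), 1 + m) := S.
have {MS} : N *m V = 1%:M by exact: MS.
suff H : N *m V = 1%:M -> exists2 G, G \in unitmx & exists2 T, T \in unitmx &
  N *m G = @row_mx _ (1 + m) (1 + m) r T 0 by exact: H.
move: N V => {S}N V NV.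
have [|G1 G1u NG1] := @unimodular_row_completable _ (usubmx N) (lsubmx V).
  rewrite mulmx_lsub mul_usub_mx NV (@scalar_mx_block _ 1 m).
  by rewrite block_mxEv col_mxKu row_mxKl.
pose N' := N *m G1; pose V' := invmx G1 *m V.
have NV' : N' *m V' = 1%:M by rewrite /N' /V' mulmxA mulmxK.
have N'E : N' = block_mx 1%:M 0 (dlsubmx N') (drsubmx N').
  by rewrite -{1}(vsubmxK N') {1}/N' -mul_usub_mx NG1 -[dsubmx N'](hsubmxK) -block_mxEv.
have N2V : drsubmx N' *m drsubmx V' = 1%:M.
  move: NV'; rewrite -[V']submxK N'E mulmx_block !mul1mx !mul0mx !addr0.
  rewrite block_mxKdr scalar_mx_block => /eq_block_mx[_ -> _].
  by rewrite mulmx0 add0r block_mxKdr.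
have [G2 G2u [T2 T2u NG2]] := IH _ _ N2V.
exists (G1 *m block_mx 1%:M 0 0 G2).
  by rewrite unitmx_mul G1u unitmxE det_ublock det1 mul1r.
exists (block_mx 1%:M 0 (dlsubmx N') T2 : 'M_(1 + m)).
  by rewrite unitmxE det_lblock det1 mul1r.
rewrite mulmxA -/N' {1}N'E mulmx_block !mul1mx !mul0mx !mulmx0 !mulmx1 !addr0 add0r.
rewrite NG2; have := @row_mxA _ (1 + m) 1 m r (col_mx 1%:M (dlsubmx N'))
  (col_mx 0 T2) (col_mx 0 0).
rewrite /= castmx_id col_mx0 -block_mxEh => <-; rewrite block_mxEh.
by congr row_mx; rewrite -[in RHS](@col_mx0 _ 1 m r) -block_mxEh block_mxEv row_mx0.
Qed.
End Completion.

(** * Idempotent matrices *)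

Section RankFactorization.
Context (A : idomainType).
Local Notation F := {fraction A}.
Local Notation tofrac := (@FracField.tofrac A).

Lemma fraction_denominator (x : F) : exists d, d != 0 /\ exists a, tofrac d * x = tofrac a.
Proof.
elim/quotW: x => x; exists (\d_x); split; first exact: denom_ratioP.
exists (\n_x); unlock FracField.tofrac; rewrite -[LHS]FracField.pi_mul.
apply/eqmodP; rewrite /= FracField.equivfE /FracField.mulf.
have d0 := denom_ratioP x.
rewrite !numden_Ratio ?oner_neq0 ?mulf_neq0 ?oner_neq0 //.
by rewrite mulr1 mul1r mulrC.
Qed.

Lemma common_denominator m n (M : 'M[F]_(m, n)) : exists d, d != 0 /\
  exists M' : 'M[A]_(m, n), tofrac d *: M = map_mx tofrac M'.
Proof.
have [d dP] := choice (fun ij : 'I_m * 'I_n => fraction_denominator (M ij.1 ij.2)).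
exists (\prod_ij d ij); split.
  by rewrite prodf_seq_neq0; apply/allP => ij _; case: (dP ij).
have [a aP] := choice (fun ij => proj2 (dP ij)).
exists (\matrix_(i, j) ((\prod_(kl | kl != (i, j)) d kl) * a (i, j))).
apply/matrixP => i j; rewrite !mxE (bigD1 (i, j))//= mulrC !rmorphM/= -aP.
by rewrite /=; ring.
Qed.

(** The rank factorization of e over the fraction field, with denominators
    cleared. It says that the image of e becomes free after inverting d. *)
Lemma idempotent_factorization n (e : 'M[A]_n) : e *m e = e ->
  exists r d (U : 'M_(n, r)) (V : 'M_(r, n)),
    [/\ d != 0, U *m V = d *: e & V *m U = d%:M].
Proof.
move=> ee; pose E := map_mx tofrac e.
have EE : E *m E = E by rewrite -map_mxM ee.
have [r [C [B [C' [B' [CB C'C BB']]]]]] : exists r (C : 'M_(n, r)) (B : 'M_(r, n))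
    (C' : 'M_(r, n)) (B' : 'M_(n, r)), [/\ C *m B = E, C' *m C = 1%:M & B *m B' = 1%:M].
  have /row_fullP[C' C'C] := col_base_full E.
  have /row_freeP[B' BB'] := row_base_free E.
  by exists (\rank E), (col_base E), (row_base E), C', B'; split; rewrite ?mulmx_base.
have BC : B *m C = 1%:M.
  have -> : B *m C = C' *m (C *m B *m (C *m B)) *m B'.
    by rewrite !mulmxA C'C mul1mx -!mulmxA BB' mulmx1.
  by rewrite CB EE -CB mulmxA C'C mul1mx BB'.
have [c [c0 [U cU]]] := common_denominator C.
have [b [b0 [V bV]]] := common_denominator B.
have inj k l : injective (map_mx tofrac : 'M_(k, l) -> 'M_(k, l)).
  move=> M M' /matrixP MM'; apply/matrixP => i j; apply/eqP.
  by rewrite -tofrac_eq; have := MM' i j; rewrite !mxE => ->.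
exists r, (c * b), U, V; split; first by rewrite mulf_neq0.
- apply: inj; rewrite map_mxM -cU -bV -scalemxAl -scalemxAr CB.
  by rewrite map_mxZ rmorphM scalerA.
- apply: inj; rewrite map_mxM -cU -bV -scalemxAl -scalemxAr BC.
  by rewrite map_scalar_mx rmorphM scalerA scalemx1 mulrC.
Qed.
End RankFactorization.

Lemma scalemx_inj (A : idomainType) (a : A) m n : a != 0 ->
  injective (fun M : 'M[A]_(m, n) => a *: M).
Proof.
move=> a0 M N /matrixP MN; apply/matrixP => i j; apply: (mulfI a0).
by have := MN i j; rewrite !mxE.
Qed.

Section Quotient.
Context (A R : idomainType) (ev : {rmorphism {poly R} -> A}) (w : {poly R}).
Hypothesis div : forall f, exists q (r : {poly R}),
  (size r < size w)%N /\ f = q * ev w + ev r.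
Hypothesis divU : forall q (r : {poly R}),
  (size r < size w)%N -> q * ev w + ev r = 0 -> q = 0 /\ r = 0.

Local Notation cst := (ev \o polyC).

Lemma division_unique q (r : {poly R}) q' (r' : {poly R}) :
  (size r < size w)%N -> (size r' < size w)%N ->
  q * ev w + ev r = q' * ev w + ev r' -> q = q' /\ r = r'.
Proof.
move=> rs rs' qr; have [||/subr0_eq -> /subr0_eq ->]// := @divU (q - q') (r - r').
  by rewrite (leq_ltn_trans (size_polyD _ _))// gtn_max size_polyN rs.
rewrite rmorphB mulrBl addrACA -opprD.
by apply/eqP; rewrite subr_eq0 qr.
Qed.

(** Uniqueness makes quotient and remainder linear over the coefficients, although
    they are only known to exist pointwise. *)
Lemma division_linear : exists (quo : A -> A) (rem : A -> {poly R}),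
  [/\ forall f, (size (rem f) < size w)%N /\ f = quo f * ev w + ev (rem f),
      forall f q (r : {poly R}), (size r < size w)%N -> f = q * ev w + ev r ->
        quo f = q /\ rem f = r,
      forall c f g, quo (cst c * f + g) = cst c * quo f + quo g
    & forall c f g, rem (cst c * f + g) = c *: rem f + rem g].
Proof.
have [quo /choice[rem qrP]] := choice div.
have qrU f q (r : {poly R}) : (size r < size w)%N -> f = q * ev w + ev r ->
    quo f = q /\ rem f = r.
  have [rs fE] := qrP f => rs' fE'.
  by apply: division_unique => //; rewrite -fE -fE'.
exists quo, rem.
have lin c f g : quo (cst c * f + g) = cst c * quo f + quo g /\
    rem (cst c * f + g) = c *: rem f + rem g.
  have [sf fE] := qrP f; have [sg gE] := qrP g; apply: qrU.
    rewrite (leq_ltn_trans (size_polyD _ _))// gtn_max sg andbT.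
    exact: leq_ltn_trans (size_scale_leq _ _) _.
  rewrite -mul_polyC rmorphD rmorphM/= {1}fE {1}gE; ring.
by split=> // c f g; case: (lin c f g).
Qed.

Lemma divisor_neq0 : ev w != 0.
Proof.
have [_ [r [rw _]]] := div 0; apply/eqP => W0.
have [||/eqP] := @divU 1 0; last by rewrite oner_eq0.
  by rewrite size_poly0; apply: leq_trans rw.
by rewrite W0 rmorph0 mulr0 addr0.
Qed.

(** Here kappa gives coordinates, over R, on the quotient of A^r by the row space of
    U. The key point is that a |-> (aV div w) e is an R-linear retraction of
    right multiplication by U from the image of e, because UV = w e; hence pi
    below is an R-linear projection with kernel the row space of U. Taking
    remainders modulo w expresses pi in finitely many coordinates; the values of
    kappa fill a direct summand of R^m, not all of it in general. *)
Lemma quotient_coordinates n r (e : 'M[A]_n) (U : 'M_(n, r)) (V : 'M_(r, n)) :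
  e *m e = e -> e *m U = U -> U *m V = ev w *: e -> V *m U = (ev w)%:M ->
  exists m (mu : 'M[A]_(m, r)) (kappa : 'rV[A]_r -> 'rV[R]_m),
  [/\ forall c a b, kappa (cst c *: a + b) = c *: kappa a + kappa b,
      forall b, kappa (b *m U) = 0
    & forall a, exists b, a = map_mx cst (kappa a) *m mu + b *m U].
Proof.
move=> ee eU UV VU; have [quo [rem [qrP qrU quoL remL]]] := division_linear.
have w0 : (0 < size w)%N by have [/(leq_trans _)->] := qrP 0.
have divW f : quo (f * ev w) = f /\ rem (f * ev w) = 0.
  by apply: qrU; rewrite ?size_poly0 ?rmorph0 ?addr0.
set d := size w in w0 *.
pose pi (a : 'rV[A]_r) := a - map_mx quo (a *m V) *m e *m U.
pose coords (b : 'rV[A]_r) : 'rV[R]_(r * d) :=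
  mxvec (\matrix_(k, j) (rem (b 0 k))`_j).
pose pow : 'cV[A]_d := \col_j ev 'X^j.
pose mu := lin1_mx
  ([eta trmx] \o [eta mulmxr pow] \o [eta vec_mx] : 'rV[A]_(r * d) -> 'rV[A]_r).
have muE z : z *m mu = (vec_mx z *m pow)^T by rewrite mul_rV_lin1.
exists (r * d)%N, mu, (coords \o pi); split=> [c a b|b|a] /=.
- have piL : pi (cst c *: a + b) = cst c *: pi a + pi b.
    rewrite /pi; have -> : map_mx quo ((cst c *: a + b) *m V) =
        cst c *: map_mx quo (a *m V) + map_mx quo (b *m V).
      by rewrite mulmxDl -scalemxAl; apply/matrixP => i j; rewrite !mxE quoL.
    by rewrite 2!mulmxDl -!scalemxAl scalerBr opprD addrACA.
  rewrite piL /coords -linearP; congr mxvec; apply/matrixP => k j.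
  by rewrite !mxE remL coefD coefZ.
- have -> : pi (b *m U) = 0.
    rewrite /pi -(mulmxA b) UV -scalemxAr.
    have quoW (B : 'M[A]_(1, n)) : map_mx quo (ev w *: B) = B.
      by apply/matrixP => i j; rewrite !mxE mulrC (divW _).1.
    by rewrite quoW -!mulmxA [e *m (e *m U)]mulmxA ee eU subrr.
  rewrite /coords -[RHS](linear0 mxvec); congr mxvec; apply/matrixP => k j.
  by rewrite !mxE -(mul0r (ev w)) (divW 0).2 coef0.
- exists (map_mx quo (a *m V) *m e + map_mx quo (pi a) *m V).
  rewrite mulmxDl addrCA -(mulmxA _ V) VU mul_mx_scalar.
  rewrite -[LHS](addrNK (map_mx quo (a *m V) *m e *m U)) -/(pi a) addrC.
  congr (_ + _); rewrite muE -map_vec_mx mxvecK; move: (pi a) => b.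
  apply/rowP => k; rewrite !mxE [LHS](qrP _).2 addrC mulrC; congr (_ + _).
  have {1}-> : rem (b 0 k) = \poly_(j < d) (rem (b 0 k))`_j.
    apply/polyP => j; rewrite coef_poly; case: ltnP => // dj.
    by rewrite nth_default// (leq_trans _ dj)// ltnW//; case: (qrP (b 0 k)).
  rewrite poly_def rmorph_sum; apply: eq_bigr => j _.
  by rewrite !mxE -mul_polyC rmorphM.
Qed.
End Quotient.

(** In this section Q is the quotient of A^r by the row space of U, which is the
    summand of R^m cut out by the idempotent E, and T is multiplication by x on
    Q. The matrix D is x - T on this summand and the identity on its complement,
    so its cokernel is Q. *)
Section Pencil.
Context (A R : idomainType) (ev : {rmorphism {poly R} -> A}) (w : {poly R}).
Hypothesis div : forall f, exists q (r : {poly R}),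
  (size r < size w)%N /\ f = q * ev w + ev r.
Hypothesis w0 : ev w != 0.
Context (cst : {rmorphism R -> A}).
Hypothesis cstE : forall c, ev c%:P = cst c.
Local Notation x := (ev 'X).

Context (m r n : nat) (U : 'M[A]_(n, r)) (V : 'M[A]_(r, n)).
Hypothesis VU : V *m U = (ev w)%:M.
Context (mu : 'M[A]_(m, r)) (kappa : 'rV[A]_r -> 'rV[R]_m).
Hypothesis kappa_linear : forall c a b, kappa (cst c *: a + b) = c *: kappa a + kappa b.
Hypothesis kappa_U : forall b, kappa (b *m U) = 0.
Hypothesis kappa_mu : forall a, exists b, a = map_mx cst (kappa a) *m mu + b *m U.

Let nfmx l (B : 'M[A]_(l, r)) : 'M[R]_(l, m) := \matrix_i kappa (row i B).

Let row_nfmx l (B : 'M[A]_(l, r)) i : row i (nfmx B) = kappa (row i B).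
Proof. exact: rowK. Qed.

Let kappa0 : kappa 0 = 0. Proof. by rewrite -(mul0mx 1 U) kappa_U. Qed.

Let kappa_add a b : kappa (a + b) = kappa a + kappa b.
Proof. by rewrite -[a in LHS]scale1r -(rmorph1 cst) kappa_linear scale1r. Qed.

Let nfmxD l (B C : 'M[A]_(l, r)) : nfmx (B + C) = nfmx B + nfmx C.
Proof. by apply/row_matrixP => i; rewrite raddfD/= !row_nfmx raddfD kappa_add. Qed.

Let nfmxU l (B : 'M[A]_(l, n)) : nfmx (B *m U) = 0.
Proof. by apply/row_matrixP => i; rewrite row_nfmx row_mul kappa_U row0. Qed.

Let nfmx_mu l (B : 'M[A]_(l, r)) : exists C, B = map_mx cst (nfmx B) *m mu + C *m U.
Proof.
have [b bP] := choice (fun i => kappa_mu (row i B)).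
exists (\matrix_i b i); apply/row_matrixP => i.
by rewrite raddfD/= !row_mul rowK -map_row row_nfmx.
Qed.

Let nfmx_mulmx k l (Z : 'M[R]_(k, l)) (B : 'M[A]_(l, r)) :
  nfmx (map_mx cst Z *m B) = Z *m nfmx B.
Proof.
apply/row_matrixP => i; rewrite row_nfmx !row_mul [RHS]mulmx_sum_row -map_row.
rewrite [X in kappa X]mulmx_sum_row (big_morph kappa kappa_add kappa0).
apply: eq_bigr => j _.
by rewrite row_nfmx !mxE -[cst _ *: _]addr0 kappa_linear kappa0 addr0.
Qed.

Let nfmxE l (B : 'M[A]_(l, r)) (p : {poly R}) :
  nfmx (ev p *: B) = nfmx B *m nfmx (ev p *: mu).
Proof.
have [C BC] := nfmx_mu B; rewrite {1}BC scalerDr !scalemxAl nfmxD.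
by rewrite nfmxU addr0 -scalemxAl scalemxAr nfmx_mulmx.
Qed.

Let E := nfmx mu.
Let T := nfmx (x *: mu).
Let C := nfmx 1%:M.
Let D := x *: map_mx cst E - map_mx cst T + (1%:M - map_mx cst E).

Let nfmxE1 l (B : 'M[A]_(l, r)) : nfmx B *m E = nfmx B.
Proof. by have := nfmxE B 1; rewrite rmorph1 !scale1r. Qed.

Let EE : E *m E = E. Proof. exact: nfmxE1. Qed.
Let ET : E *m T = T. Proof. by rewrite -nfmxE. Qed.

Let cstM k l q (B : 'M[R]_(k, l)) (B' : 'M_(l, q)) :
  map_mx cst (B *m B') = map_mx cst B *m map_mx cst B'.
Proof. exact: map_mxM. Qed.

Let ED : map_mx cst E *m D = x *: map_mx cst E - map_mx cst T.
Proof.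
rewrite /D mulmxDr !mulmxBr -scalemxAr -!cstM EE ET.
by rewrite mulmx1 addrN addr0.
Qed.

Let ECD : (1%:M - map_mx cst E) *m D = 1%:M - map_mx cst E.
Proof. by rewrite mulmxBl mul1mx ED /D addrC addKr. Qed.

Let xT : x%:M - map_mx cst T = (map_mx cst E + x *: (1%:M - map_mx cst E)) *m D.
Proof.
rewrite mulmxDl -scalemxAl ECD ED scalerBr scalemx1.
by rewrite [RHS]addrC addrA addrNK.
Qed.

(** In the cokernel of D multiplication by x is T, which computes the coordinates
    of the multiples of mu by powers of x. Since w kills Q, the case p = w says
    that D divides w. *)
Let evD (p : {poly R}) : exists Y,
  (ev p)%:M = map_mx cst (nfmx (ev p *: mu)) + Y *m D.
Proof.
elim/poly_ind: p => [|p c [Y pY]].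
  exists 0; rewrite rmorph0 scale0r mul0mx addr0 -(mul0mx _ U) nfmxU map_mx0.
  by rewrite raddf0.
exists (x *: Y + map_mx cst (nfmx (ev p *: mu)) *m
    (map_mx cst E + x *: (1%:M - map_mx cst E)) + cst c *: (1%:M - map_mx cst E)).
have -> : nfmx (ev (p * 'X + c%:P) *: mu) = nfmx (ev p *: mu) *m T + c *: E.
  rewrite rmorphD rmorphM scalerDl nfmxD mulrC -scalerA nfmxE; congr (_ + _).
  by rewrite cstE -mul_scalar_mx -(map_scalar_mx cst) nfmx_mulmx mul_scalar_mx.
have -> : (ev (p * 'X + c%:P))%:M = x *: (ev p)%:M + cst c *: 1%:M :> 'M[A]_m.
  by rewrite rmorphD rmorphM cstE raddfD/= mulrC scale_scalar_mx scalemx1.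
rewrite pY map_mxD map_mxZ cstM !mulmxDl -mulmxA -xT -!scalemxAl ECD.
rewrite mulmxBr mul_mx_scalar.
by apply/matrixP => i j; rewrite !mxE; ring.
Qed.

Let wD : exists Y, (ev w)%:M = Y *m D.
Proof.
have [Y ->] := evD w; exists Y.
have -> : ev w *: mu = mu *m V *m U by rewrite -mulmxA VU mul_mx_scalar.
by rewrite nfmxU map_mx0 add0r.
Qed.

(** Reducing each entry modulo w leaves a polynomial, to which [evD] applies; so a
    vector lies in the image of D as soon as its class in Q is zero. *)
Let muD l (Z : 'M[A]_(l, m)) : exists Y, Z = map_mx cst (nfmx (Z *m mu)) + Y *m D.
Proof.
suff rowD (z : 'rV[A]_m) : exists Y, z = map_mx cst (kappa (z *m mu)) + Y *m D.
  have [y yP] := choice (fun i => rowD (row i Z)).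
  exists (\matrix_i y i); apply/row_matrixP => i.
  by rewrite raddfD/= row_mul rowK -map_row row_nfmx row_mul.
pose G (a : 'rV[A]_m) := exists Y, a = map_mx cst (kappa (a *m mu)) + Y *m D.
have GD a b : G a -> G b -> G (a + b).
  move=> [Y aY] [Y' bY]; exists (Y + Y'); rewrite {1}aY {1}bY.
  by rewrite !mulmxDl kappa_add map_mxD addrACA.
have Gev p i : G (ev p *: delta_mx 0 i).
  have [Y pY] := evD p; exists (row i Y).
  have -> : (ev p *: delta_mx 0 i) *m mu = row i (ev p *: mu).
    by rewrite rowE -scalemxAl -scalemxAr.
  by rewrite -mul_mx_scalar pY mulmxDr -!rowE row_mul -map_row row_nfmx.
have [Y0 wY] := wD.
have wmu (a : 'rV[A]_m) : (ev w *: a) *m mu = a *m mu *m V *m U.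
  by rewrite -(mulmxA _ V) VU mul_mx_scalar scalemxAl.
have Gw a : G (ev w *: a).
  by exists (a *m Y0); rewrite wmu kappa_U map_mx0 add0r -mulmxA -wY mul_mx_scalar.
have G0 : G 0.
  have -> : (0 : 'rV[A]_m) = ev w *: 0 by rewrite scaler0.
  exact: Gw.
suff : G z by [].
rewrite [z]row_sum_delta; apply: big_ind => // i _.
have [q [f [_ ->]]] := div (z 0 i).
by rewrite scalerDl mulrC -scalerA; apply: GD.
Qed.

Let D_regular k (Z : 'M[A]_(k, m)) : Z *m D = 0 -> Z = 0.
Proof.
move=> ZD; have [Y wY] := wD.
have detD : \det D != 0.
  apply: contraNneq w0 => D0; move/(congr1 determinant): wY.
  rewrite det_mulmx D0 mulr0 det_scalar => /eqP; rewrite expf_eq0.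
  by case/andP.
apply: (scalemx_inj detD).
by rewrite -mul_mx_scalar -mul_mx_adj mulmxA ZD mul0mx scaler0.
Qed.

Let imageD l (Z : 'M[A]_(l, m)) B : Z *m mu = B *m U -> exists Y, Z = Y *m D.
Proof.
move=> ZB; have [Y] := muD Z; rewrite ZB nfmxU map_mx0 add0r => ->.
by exists Y.
Qed.

(** The exact sequences A^m -> A^m -> Q, through D, and A^n -> A^r -> Q, through U,
    are two presentations of Q. By the argument of Schanuel's lemma, the kernel
    of the surjection given by D and C projects isomorphically onto the row space
    of U. *)
Lemma pencil_presentation : exists (D : 'M[A]_m) (C : 'M[A]_(r, m)),
  [/\ exists Y X, Y *m D + X *m C = 1%:M,
      forall k (Z : 'M_(k, m)), Z *m D = 0 -> Z = 0,
      exists Z, U *m C = Z *m D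
    & forall k (Z : 'M_(k, m)) (X : 'M_(k, r)), Z *m D + X *m C = 0 ->
        exists B, X = B *m U].
Proof.
pose C' := map_mx cst C; exists D, C'.
have [B C'mu] : exists B, C' *m mu = 1%:M - B *m U.
  have [B CB] := nfmx_mu 1%:M; exists B.
  by apply/eqP; rewrite -subr_eq opprK -CB.
have [B' Dmu] : exists B', D *m mu = B' *m U.
  have [B1 EB] := nfmx_mu mu; have [B2 TB] := nfmx_mu (x *: mu).
  exists (B1 + B2 - x *: B1).
  rewrite /D [LHS]mulmxDl !mulmxBl -scalemxAl mul1mx.
  rewrite -/E in EB; rewrite -/T in TB.
  have -> : map_mx cst E *m mu = mu - B1 *m U by rewrite {2}EB addrK.
  have -> : map_mx cst T *m mu = x *: mu - B2 *m U by rewrite TB addrK.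
  rewrite [in RHS]mulmxDl -scalemxAl.
  move: (B1 *m U) (B2 *m U) => Z1 Z2; apply/matrixP => i j; rewrite !mxE; ring.
split=> [|k Z|| k Z X ZX].
- have [Y Y1] : exists Y, 1%:M - mu *m C' = Y *m D.
    apply: (@imageD _ _ (mu *m B)).
    rewrite mulmxBl mul1mx -(mulmxA mu C') C'mu mulmxBr mulmx1 opprB addrC subrK.
    by rewrite mulmxA.
  by exists Y, mu; rewrite -Y1 subrK.
- exact: D_regular.
- apply: (@imageD _ _ (1%:M - U *m B)).
  by rewrite -(mulmxA U C') C'mu mulmxBr mulmx1 mulmxBl mul1mx mulmxA.
- exists (X *m B - Z *m B').
  have : (Z *m D + X *m C') *m mu = 0 by rewrite ZX mul0mx.
  rewrite mulmxDl -(mulmxA Z) -(mulmxA X) Dmu C'mu mulmxBr mulmx1 mulmxBl.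
  rewrite addrCA -!mulmxA => /eqP; rewrite addr_eq0 opprB => /eqP <-.
  by [].
Qed.

End Pencil.

Section IdempotentFree.
Context (A : idomainType).
Hypothesis A_weierstrass : forall d : A, d != 0 -> weierstrass_divisor d.

(** The last r rows of a completing matrix form a basis of the kernel of the
    surjection given by D and C; their second components are then a basis of the
    row space of U. *)
Lemma presented_free m r n (D : 'M[A]_m) (C : 'M[A]_(r, m)) (U : 'M[A]_(n, r)) :
  (exists Y X, Y *m D + X *m C = 1%:M) ->
  (forall k (Z : 'M_(k, m)), Z *m D = 0 -> Z = 0) ->
  (exists Z, U *m C = Z *m D) ->
  (forall k (Z : 'M_(k, m)) (X : 'M_(k, r)), Z *m D + X *m C = 0 ->
     exists B, X = B *m U) ->
  exists X X', U = X' *m (X *m U) /\ forall k (Z : 'M_(k, r)), Z *m (X *m U) = 0 -> Z = 0.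
Proof.
move=> [Y [X YX]] Dreg [W UC] ker.
have [|G Gu [T Tu GT]] := @unimodular_mx_completion _ A_weierstrass m r
    (col_mx D C)^T (row_mx Y X)^T.
  by rewrite -trmx_mul mul_row_col YX trmx1.
pose H := G^T; have Hu : H \in unitmx by rewrite unitmx_tr.
have HDC : H *m col_mx D C = col_mx T^T 0.
  by rewrite -[LHS]trmxK trmx_mul trmxK GT tr_row_mx trmx0.
pose Z2 := lsubmx (dsubmx H); pose L := rsubmx (dsubmx H).
have H2 : dsubmx H = row_mx Z2 L by rewrite hsubmxK.
have Z2L : Z2 *m D + L *m C = 0.
  by rewrite -mul_row_col -H2 mul_dsub_mx HDC col_mxKd.
have [B LB] := ker _ _ _ Z2L.
pose g := row_mx (- W) U *m invmx H.
have gE : row_mx (- W) U = g *m H by rewrite mulmxKV.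
have g1 : lsubmx g = 0.
  have : g *m H *m col_mx D C = 0.
    by rewrite -gE mul_row_col UC mulNmx addNr.
  rewrite -mulmxA HDC -{1}[g]hsubmxK mul_row_col mulmx0 addr0.
  move/(congr1 (mulmx^~ (invmx T^T))); rewrite mulmxK ?unitmx_tr// mul0mx.
  exact.
exists B, (rsubmx g); split.
  have : rsubmx (row_mx (- W) U) = rsubmx (g *m H) by rewrite gE.
  rewrite row_mxKr -{1}[g]hsubmxK g1 -[H]vsubmxK mul_row_col mul0mx add0r.
  by rewrite -mulmx_rsub -/L LB.
rewrite -LB => k Z ZL.
have ZZ2 : Z *m Z2 = 0.
  apply: Dreg; have : Z *m (Z2 *m D + L *m C) = 0 by rewrite Z2L mulmx0.
  by rewrite mulmxDr !mulmxA ZL mul0mx addr0.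
have : row_mx 0 Z *m H = 0.
  by rewrite -[H]vsubmxK mul_row_col mul0mx add0r H2 mul_mx_row ZZ2 ZL row_mx0.
move/(congr1 (mulmx^~ (invmx H))); rewrite mulmxK// mul0mx.
by rewrite -[0 in RHS]row_mx0 => /eq_row_mx[].
Qed.

Theorem idempotent_free n (e : 'M[A]_n) : e *m e = e ->
  exists r (B : 'M_(r, n)) (X : 'M_(n, r)), e = X *m B /\ B *m X = 1%:M.
Proof.
move=> ee; have [r [d [U [V [d0 UV VU]]]]] := idempotent_factorization ee.
have [R [ev [w [wm _ [u uu evw] div divU]]]] := A_weierstrass d0.
have w0 := divisor_neq0 div divU.
pose V' := u *: V.
have UV' : U *m V' = ev w *: e by rewrite -scalemxAr UV scalerA mulrC -evw.
have VU' : V' *m U = (ev w)%:M by rewrite -scalemxAl VU scale_scalar_mx mulrC -evw.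
have eU : e *m U = U.
  by apply: (scalemx_inj w0); rewrite scalemxAl -UV' -mulmxA VU' mul_mx_scalar.
have [m [mu [kappa [kappa_linear kappa_U kappa_mu]]]] :=
  quotient_coordinates div divU ee eU UV' VU'.
have [D [C [DC Dreg UC ker]]] :=
  pencil_presentation (cst := ev \o polyC) div w0 (fun=> erefl) VU'
    kappa_linear kappa_U kappa_mu.
have [X [X' [UX XU]]] := presented_free DC Dreg UC ker.
have eXX : e = X' *m (X *m e).
  apply: (scalemx_inj w0) => /=.
  by rewrite -UV' {1}UX -!mulmxA UV' -!scalemxAr.
exists r, (X *m e), X'; split => //; apply/eqP; rewrite -subr_eq0; apply/eqP.
by apply: XU; rewrite mulmxBl mul1mx -(mulmxA (X *m e)) -UX -mulmxA eU subrr.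
Qed.
End IdempotentFree.

(** * From idempotent matrices to projective modules *)

Section ProjectiveFree.
Context (A : comNzRingType) (M : lmodType A).

Definition basis_tuple r (b : 'I_r -> M) : Prop :=
  (forall x, exists z : 'I_r -> A, x = \sum_k z k *: b k) /\
  (forall z : 'I_r -> A, \sum_k z k *: b k = 0 -> forall k, z k = 0).

Lemma basis_tuple_free r (b : 'I_r -> M) : basis_tuple b -> free_module M.
Proof.
move=> [bspan bfree].
have b_inj : injective b.
  move=> k l bkl; apply/eqP/negPn/negP => kl.
  have delta i : \sum_j (j == i)%:R *: b j = b i.
    rewrite (bigD1 i)//= eqxx scale1r big1 ?addr0// => j /negbTE ->.
    by rewrite scale0r.
  have /bfree/(_ k)/eqP : \sum_i ((i == k)%:R - (i == l)%:R) *: b i = 0.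
    by under eq_bigr do rewrite scalerBl; rewrite sumrB !delta bkl subrr.
  by rewrite eqxx (negbTE kl) subr0 oner_eq0.
exists [set y | exists k, y = b k]; split=> [S c SB Sc y yS|x].
- have [k yk] := SB _ yS; rewrite yk.
  pose z k := if b k \in S then c (b k) else 0.
  have <- : z k = c (b k) by rewrite /z -yk yS.
  apply: bfree; rewrite -[RHS]Sc.
  have Sb : perm_eq S [seq b k | k <- enum 'I_r & b k \in S].
    apply: uniq_perm; first exact: fset_uniq.
      by rewrite map_inj_uniq// filter_uniq// enum_uniq.
    move=> u; apply/idP/mapP => [uS|[l]].
      have [l ul] := SB _ uS; exists l => //.
      by rewrite mem_filter -ul uS mem_enum.
    by rewrite mem_filter => /andP[+ _] ->.
  rewrite (perm_big _ Sb)/= big_map big_filter big_enum_cond [RHS]big_mkcond/=.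
  by apply: eq_bigr => i _; rewrite /z; case: ifP => //; rewrite scale0r.
- have [z ->] := bspan x.
  pose c y := if [pick k | b k == y] is Some k then z k else 0.
  have cb k : c (b k) = z k.
    rewrite /c; case: pickP => [l /eqP/b_inj ->//|/(_ k)].
    by rewrite eqxx.
  exists [fset b k | k in 'I_r]%fset, c; split=> [y /imfsetP[k _ ->]|].
    by exists k.
  rewrite big_imfset/=; last by move=> k l _ _; exact: b_inj.
  rewrite big_enum/=; apply: eq_bigr => k _.
  by rewrite cb.
Qed.

Lemma projective_free :
  (forall n (e : 'M[A]_n), e *m e = e -> exists r (B : 'M_(r, n)) (X : 'M_(n, r)),
     e = X *m B /\ B *m X = 1%:M) ->
  finitely_generated M -> projective M -> free_module M.
Proof.
move=> split_idem [S Sgen] Mproj.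
pose n := size S; pose s (i : 'I_n) := nth 0 S i.
pose g (a : 'rV[A]_n) : M := \sum_i a 0 i *: s i.
have g_linear : linear g.
  move=> c a b; rewrite /g scaler_sumr -big_split; apply: eq_bigr => i _ /=.
  by rewrite !mxE scalerDl scalerA.
pose gl : {linear 'rV[A]_n -> M} :=
  HB.pack g (GRing.isLinear.Build A 'rV[A]_n M *:%R g g_linear).
have [|h gh] := Mproj 'rV[A]_n M gl idfun.
  move=> x; have [c xc] := Sgen x; exists (\row_i c (s i)).
  rewrite xc (big_nth 0) big_mkord; apply: eq_bigr => i _.
  by rewrite mxE.
pose e : 'M[A]_n := \matrix_i h (s i).
have hg a : h (g a) = a *m e.
  rewrite mulmx_sum_row /g linear_sum; apply: eq_bigr => i _.
  by rewrite linearZ rowK.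
have [r [B [X [eXB BX]]]] : exists r (B : 'M_(r, n)) (X : 'M_(n, r)),
    e = X *m B /\ B *m X = 1%:M.
  apply: split_idem; apply/row_matrixP => i.
  by rewrite row_mul rowK -hg; congr (h _); exact: gh.
pose b k := g (row k B).
have gB (z : 'rV_r) : g (z *m B) = \sum_k z 0 k *: b k.
  rewrite mulmx_sum_row -[g _]/(gl _) linear_sum; apply: eq_bigr => k _.
  by rewrite linearZ.
have hb (z : 'rV_r) : h (g (z *m B)) = z *m B.
  by rewrite hg eXB mulmxA -(mulmxA z) BX mulmx1.
apply: (@basis_tuple_free r b); split=> [x|z zb k].
  exists ((h x *m X) 0); rewrite -gB -mulmxA -eXB -hg.
  by rewrite -[g (h x)]/(gl (h x)) gh; exact/esym/gh.
have zB : (\row_k z k) *m B = 0.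
  rewrite -hb gB; under eq_bigr do rewrite mxE.
  by rewrite zb linear0.
have : (\row_k z k) *m B *m X = 0 by rewrite zB mul0mx.
by rewrite -mulmxA BX mulmx1 => /rowP/(_ k); rewrite !mxE.
Qed.
End ProjectiveFree.

(** * Extrema and separating linear forms *)

Section Auxiliary.
Context (R : realType).

Lemma geometric_small (th C e : R) : 0 <= th < 1 -> 0 < C -> 0 < e ->
  exists N, C * th ^+ N < e.
Proof.
move=> /andP[th0 th1] C0 e0; have [->|thn0] := eqVneq th 0.
  by exists 1%N; rewrite expr1 mulr0.
have thp : 0 < th by rewrite lt_neqAle eq_sym thn0.
pose h := th^-1 - 1; have h0 : 0 < h by rewrite subr_gt0 invf_gt1.
have bern N : 1 + h *+ N <= th^-1 ^+ N.
  elim: N => [|N IH]; first by rewrite mulr0n addr0 expr0.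
  have -> : th^-1 = 1 + h by rewrite /h addrC subrK.
  rewrite exprS mulrDl mul1r mulrS addrCA addrC lerD//.
    by have -> : 1 + h = th^-1 by rewrite /h addrC subrK.
  rewrite ler_peMr ?(ltW h0)// exprn_ege1//; lra.
exists (Num.bound (C / e / h)); set N := Num.bound _.
have hN : C / e / h < N%:R.
  by apply: archi_boundP; rewrite !divr_ge0// ltW.
have : C / e < th^-1 ^+ N.
  apply: lt_le_trans (bern N); rewrite -mulr_natl.
  by move: hN; rewrite ltr_pdivrMr//; lra.
by rewrite exprVn ltr_pdivrMr// mulrC ltr_pdivlMr ?exprn_gt0// mulrC.
Qed.

Lemma seq_argmax (T : eqType) (d : Order.disp_t) (O : orderType d)
    (s : seq T) (F : T -> O) :
  s != [::] -> exists2 i, i \in s & forall j, j \in s -> (F j <= F i)%O.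
Proof.
elim: s => // a s IH _; have [->|/IH[i si imax]] := eqVneq s [::].
  by exists a; rewrite ?mem_head// => j; rewrite inE => /eqP ->.
have [ai|/ltW ia] := leP (F a) (F i).
  exists i; first by rewrite inE si orbT.
  by move=> j; rewrite inE => /predU1P[->//|]; exact: imax.
exists a; first exact: mem_head.
by move=> j; rewrite inE => /predU1P[->//|/imax/le_trans]; apply.
Qed.

Lemma seq_gap (T : eqType) (s : seq T) (F : T -> R) (M : R) : 0 < M ->
  (forall i, i \in s -> F i < M) ->
  exists2 th, 0 < th < 1 & forall i, i \in s -> F i <= th * M.
Proof.
move=> M0; elim: s => [|a s IH] sM.
  by exists (1 / 2) => //; lra.
have [|th /andP[th0 th1] sth] := IH.
  by move=> i si; apply: sM; rewrite inE si orbT.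
exists (Num.max th (F a / M)).
  rewrite lt_max th0 gt_max th1/= ltr_pdivrMr// mul1r.
  exact/sM/mem_head.
move=> i; rewrite inE => /predU1P[->|/sth/le_trans].
  by rewrite -ler_pdivrMr// le_max lexx orbT.
by apply; rewrite ler_pM2r// le_max lexx.
Qed.

End Auxiliary.

Section SeparatingForm.

Lemma digits_zero (B : nat) m (v : 'I_m -> int) : (0 < B)%N ->
  (forall k, (`|v k| < B)%N) -> \sum_k v k * B%:Z ^+ k = 0 -> forall k, v k = 0.
Proof.
move=> B0; elim: m v => [|m IH] v vB; first by move=> _ [].
rewrite big_ord_recl expr0 mulr1.
under eq_bigr do rewrite /bump /= exprS mulrCA; rewrite -mulr_sumr => v0.
have v00 : v ord0 = 0.
  apply/eqP; rewrite -absz_eq0 -leqn0 leqNgt; apply/negP => /dvdn_leq.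
  move=> /(_ B); rewrite leqNgt vB => /(_ _)/notF; apply.
  have -> : v ord0 = - (B%:Z * \sum_(i < m) v (lift ord0 i) * B%:Z ^+ i).
    by apply/eqP; rewrite -addr_eq0 v0.
  by rewrite abszN abszM dvdn_mulr.
move: v0; rewrite v00 add0r => /eqP; rewrite mulf_eq0 => /orP[/eqP B00|/eqP v0].
  by case: B00 B0 => ->.
move=> k; case: (unliftP ord0 k) => [j ->|->//].
by apply: (IH (fun k => v (lift ord0 k))) => //.
Qed.

Context (n : nat).

(** Reading exponents as digits in a base larger than all their differences
    separates them, and the unit digit gives a vector of value 1. *)
Lemma separating_form (s : seq 'rV[int]_n) : exists phi : {additive 'rV[int]_n -> int},
  (forall i j, i \in s -> j \in s -> phi i = phi j -> i = j) /\
  ((0 < n)%N -> exists e, phi e = 1).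
Proof.
(* differences of two entries have absolute value less than B *)
pose B := (\sum_(i <- s) (multi_norm i).*2).+1.
pose f (i : 'rV[int]_n) := \sum_(k < n) i 0 k * B%:Z ^+ k.
have fB : zmod_morphism f.
  move=> i j; rewrite /f -sumrB; apply: eq_bigr => k _.
  by rewrite !mxE mulrBl.
pose phi : {additive 'rV[int]_n -> int} := HB.pack f (GRing.isZmodMorphism.Build _ _ f fB).
exists phi; split=> [i j si sj /eqP|n0]; last first.
  exists (delta_mx 0 (Ordinal n0)).
  rewrite /= /f (bigD1 (Ordinal n0))//= mxE !eqxx expr0 mulr1 big1 ?addr0// => k k0.
  by rewrite mxE (negbTE k0) andbF mul0r.
rewrite -subr_eq0 -raddfB => /eqP ij.
have small (l : 'rV[int]_n) k : (`|l 0%R k| <= multi_norm l)%N.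
  by rewrite /multi_norm (bigD1 k)//= leq_addr.
have big (l : 'rV[int]_n) : l \in s -> ((multi_norm l).*2 < B)%N.
  by move=> sl; rewrite ltnS (big_rem l)//= leq_addr.
have B0 : (0 < B)%N by [].
apply/rowP => k; apply/eqP; rewrite -subr_eq0; apply/eqP.
have := @digits_zero B n (fun k => (i - j) 0 k) B0 _ ij k; rewrite !mxE; apply => l.
rewrite !mxE; have [le_ij|/ltnW le_ij] := leqP (multi_norm i) (multi_norm j).
  apply: leq_ltn_trans (big j sj); rewrite -addnn.
  apply: leq_trans (leqD_dist (i 0 l) 0 (j 0 l)) _; rewrite subr0 sub0r abszN.
  by rewrite leq_add ?small// (leq_trans (small _ _)).
apply: leq_ltn_trans (big i si); rewrite -addnn.
apply: leq_trans (leqD_dist (i 0 l) 0 (j 0 l)) _; rewrite subr0 sub0r abszN.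
by rewrite leq_add ?small// (leq_trans (small _ _)).
Qed.

End SeparatingForm.

(** * The Gauss norm and dominant terms *)

Local Open Scope fset_scope.
Local Open Scope ring_scope.

Lemma fset_argmax (T : choiceType) (S : {fset T}) (F : T -> int) : S != fset0 ->
  exists2 i, i \in S & forall j, j \in S -> F j <= F i.
Proof.
move=> S0; have [|i iS imax] := @seq_argmax _ _ _ (enum_fset S) F.
  by case/fset0Pn: S0 => i; apply: contraTneq => S0;
    rewrite -[_ \in S]/(i \in enum_fset S) S0.
by exists i.
Qed.

Section GaussNorm.
Context (R : realType) (K : completeNonarchFieldType R) (n : nat).
Context (rho : 'I_n -> {posnum R}).
Local Notation A := (laurent K rho).
Local Notation Zn := 'rV[int]_n.
Implicit Types (f g : A) (i j : Zn).

Lemma laurentP f g : (forall i, f i = g i) <-> f = g.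
Proof. by split=> [fg|->//]; apply/val_inj/funext. Qed.

Lemma lcoefD f g i : (f + g) i = f i + g i. Proof. by []. Qed.
Lemma lcoefN f i : (- f) i = - f i. Proof. by []. Qed.
Lemma lcoef0 i : (0 : A) i = 0. Proof. by []. Qed.
Lemma lcoef1 i : (1 : A) i = (i == 0)%:R. Proof. by []. Qed.
Lemma lcoefM f g k : (f * g) k = infsum (fun i => f i * g (k - i)).
Proof. by []. Qed.

Lemma lcoef_sum (I : Type) (s : seq I) (P : pred I) (F : I -> A) i :
  (\sum_(l <- s | P l) F l) i = \sum_(l <- s | P l) F l i.
Proof. exact: (big_morph (fun f : A => f i) (fun f g => lcoefD f g i) (lcoef0 i)). Qed.

Definition gauss_le f (C : R) : Prop := forall i, wnorm rho f i <= C.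

Lemma gauss_le_ge0 f C : gauss_le f C -> 0 <= C.
Proof. by move=> fC; exact: le_trans (wnorm_ge0 rho f 0) (fC 0). Qed.

Lemma gauss_leP f C : gauss_le f C <-> forall i, nanorm (f i) <= C / radius_exp rho i.
Proof.
by split=> h i; have := h i; rewrite /wnorm ler_pdivlMr ?radius_exp_gt0.
Qed.

Lemma gauss_leW f C C' : C <= C' -> gauss_le f C -> gauss_le f C'.
Proof. by move=> CC' fC i; exact: le_trans (fC i) CC'. Qed.

Lemma gauss_le0 C : 0 <= C -> gauss_le 0 C.
Proof. by move=> C0 i; rewrite /wnorm nanorm0 mul0r. Qed.

Lemma gauss_leN f C : gauss_le f C -> gauss_le (- f) C.
Proof. by move=> fC i; rewrite /wnorm lcoefN nanormN; exact: fC. Qed.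

Lemma gauss_leD f g C : gauss_le f C -> gauss_le g C -> gauss_le (f + g) C.
Proof.
move=> /gauss_leP fC /gauss_leP gC; apply/gauss_leP => i.
by rewrite lcoefD; apply: nanormD_le.
Qed.

Lemma gauss_leB f g C : gauss_le f C -> gauss_le g C -> gauss_le (f - g) C.
Proof. by move=> fC gC; apply: gauss_leD => //; exact: gauss_leN. Qed.

Lemma gauss_leM f g C C' : gauss_le f C -> gauss_le g C' -> gauss_le (f * g) (C * C').
Proof.
move=> fC gC'; apply/gauss_leP => k; rewrite lcoefM; apply: infsum_le.
- rewrite divr_ge0 ?(ltW (radius_exp_gt0 _ _))// mulr_ge0//.
    exact: gauss_le_ge0 fC.
  exact: gauss_le_ge0 gC'.
- by apply: null_mul; exact: lcoef_decaying.
- move=> i; rewrite ler_pdivlMr ?radius_exp_gt0// wnormM.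
  by apply: ler_pM; rewrite ?wnorm_ge0.
Qed.

Lemma gauss_le_eq0 f : (forall e, 0 < e -> gauss_le f e) -> f = 0.
Proof.
move=> f0; apply/laurentP => i; rewrite lcoef0; apply: nanorm_le0 => e e0.
have r0 := radius_exp_gt0 rho i.
have /gauss_leP/(_ i) := f0 _ (mulr_gt0 e0 r0).
by rewrite mulfK// gt_eqF.
Qed.

Lemma gauss_bounded f : exists2 C, 0 < C & gauss_le f C.
Proof. exact: decaying_bounded (lcoef_decaying f). Qed.

(** Completeness of the ring of series, in the form needed by successive
    approximations: the remainders are estimated, and supports do not grow. *)
Lemma gauss_series (g : nat -> A) (C th : R) : 0 <= th < 1 -> 0 < C ->
  (forall k, gauss_le (g k) (C * th ^+ k)) -> exists s : A,
  (forall k, gauss_le (s - \sum_(l < k) g l) (C * th ^+ k)) /\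
  (forall i, (forall k, g k i = 0) -> s i = 0).
Proof.
move=> th01 C0 gC; have /andP[th0 th1] := th01.
have anti k l : (k <= l)%N -> C * th ^+ l <= C * th ^+ k.
  move=> kl; rewrite ler_pM2l// -(subnK kl) exprD ler_piMl ?exprn_ge0//.
  by rewrite exprn_ile1// ltW.
pose s i := infsum (fun k => g k i).
have g_null i : null_family (fun k => g k i).
  move=> e e0; have r0 := radius_exp_gt0 rho i.
  have [N hN] := geometric_small th01 C0 (mulr_gt0 e0 r0).
  exists [fset l | l in iota 0 N] => k kN.
  have /gauss_leP/(_ i)/le_trans := gC k; apply.
  rewrite ler_pdivrMr//; apply: le_trans (ltW hN); apply: anti.
  rewrite leqNgt; apply: contraNN kN => kN; apply/imfsetP; exists k => //=.
  by rewrite mem_iota.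
have s_tail k i : nanorm (s i - \sum_(l < k) g l i) <= C * th ^+ k / radius_exp rho i.
  have -> : \sum_(l < k) g l i = \sum_(l <- [fset l | l in iota 0 k]) g l i.
    rewrite big_imfset//= -(big_mkord xpredT (fun l => g l i)).
    by rewrite undup_id ?iota_uniq// /index_iota subn0.
  apply: has_sum_tail; last exact: null_has_sum.
    by rewrite divr_ge0 ?(ltW (radius_exp_gt0 _ _))// mulr_ge0 ?exprn_ge0// ltW.
  move=> l lk; have /gauss_leP/(_ i)/le_trans := gC l; apply.
  rewrite ler_pM2r ?invr_gt0 ?radius_exp_gt0//; apply: anti.
  rewrite leqNgt; apply: contraNN lk => lk; apply/imfsetP; exists l => //=.
  by rewrite mem_iota.
have s_dec : decaying rho s.
  move=> e e0; have [k hk] := geometric_small th01 C0 e0.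
  have [N hN] := lcoef_decaying (\sum_(l < k) g l) e0.
  exists N => i /hN; rewrite -!ltr_pdivlMr ?radius_exp_gt0// => h1.
  rewrite -(subrK ((\sum_(l < k) g l) i) (s i)); apply: nanormD_lt => //.
  rewrite lcoef_sum; apply: le_lt_trans (s_tail k i) _.
  by rewrite ltr_pM2r ?invr_gt0 ?radius_exp_gt0.
exists (Laurent (asboolT s_dec)); split=> [k|i gi].
  by apply/gauss_leP => i; rewrite lcoefD lcoefN lcoef_sum; exact: s_tail.
rewrite /= /s; apply: has_sumE.
have := @has_sum_fin _ _ _ (fun k => g k i) fset0.
by rewrite big_seq_fset0; apply => k _; exact: gi.
Qed.

Lemma finite_support_decaying (u : Zn -> K) (S : {fset Zn}) :
  (forall i, i \notin S -> u i = 0) -> decaying rho u.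
Proof.
move=> uS e e0; exists (\sum_(i <- S) multi_norm i).+1 => i iN.
rewrite uS ?nanorm0 ?mul0r//; apply: contraL iN => iS.
by rewrite -leqNgt (big_fsetD1 i)//= leq_addr.
Qed.

Lemma monomial_decaying (a : K) i : decaying rho (fun j => if j == i then a else 0).
Proof.
by apply: (@finite_support_decaying _ [fset i]) => j; rewrite inE => /negbTE ->.
Qed.

Definition monomial (a : K) i : A := Laurent (asboolT (monomial_decaying a i)).

Lemma monomialE a i j : monomial a i j = if j == i then a else 0. Proof. by []. Qed.

Lemma monomialM a i f k : (monomial a i * f) k = a * f (k - i).
Proof.
rewrite lcoefM; apply: has_sumE.
have := @has_sum_fin _ _ _ (fun j => monomial a i j * f (k - j)) [fset i].
rewrite big_seq_fset1 monomialE eqxx; apply => j.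
by rewrite inE monomialE => /negbTE ->; rewrite mul0r.
Qed.

Lemma monomial_mul a b i j : monomial a i * monomial b j = monomial (a * b) (i + j).
Proof.
apply/laurentP => k; rewrite monomialM !monomialE subr_eq [j + i]addrC.
by case: ifP => // _; rewrite mulr0.
Qed.

Lemma monomial1 : monomial 1 0 = 1.
Proof. by apply/laurentP => i; rewrite monomialE lcoef1; case: eqP. Qed.

Lemma monomial_unit a i : a != 0 -> monomial a i * monomial a^-1 (- i) = 1.
Proof. by move=> a0; rewrite monomial_mul divff// subrr monomial1. Qed.

Lemma gauss_monomial a i C : 0 <= C -> nanorm a * radius_exp rho i <= C ->
  gauss_le (monomial a i) C.
Proof.
move=> C0 aC j; rewrite /wnorm monomialE; case: eqP => [->//|_].
by rewrite nanorm0 mul0r.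
Qed.

Lemma restriction_decaying (P : pred Zn) f :
  decaying rho (fun i => if P i then f i else 0).
Proof.
move=> e e0; have [N hN] := lcoef_decaying f e0; exists N => i /hN fi.
by case: ifP => // _; rewrite nanorm0 mul0r.
Qed.

Definition restriction P f : A := Laurent (asboolT (restriction_decaying P f)).

Lemma restrictionE P f i : restriction P f i = if P i then f i else 0.
Proof. by []. Qed.

Lemma gauss_restriction P f C : gauss_le f C -> gauss_le (restriction P f) C.
Proof.
move=> fC i; rewrite /wnorm restrictionE; case: ifP => _; first exact: fC.
by rewrite nanorm0 mul0r (gauss_le_ge0 fC).
Qed.

Lemma restriction_fset (S : {fset Zn}) f :
  restriction [pred i | i \in S] f = \sum_(i <- S) monomial (f i) i.
Proof.
apply/laurentP => k; rewrite restrictionE /= lcoef_sum.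
have [kS|kS] := boolP (k \in S).
  rewrite (big_fsetD1 k)// monomialE eqxx big1_fset => [|i]; first by rewrite /= addr0.
  by rewrite !inE monomialE eq_sym => /andP[/negbTE ->].
rewrite big_seq big1// => i iS; rewrite monomialE.
by case: eqP => // ki; rewrite ki iS in kS.
Qed.

Lemma restrictionC P f : f = restriction P f + restriction (predC P) f.
Proof.
apply/laurentP => i; rewrite lcoefD !restrictionE /=.
by case: (P i); rewrite ?addr0 ?add0r.
Qed.

Lemma nanorm_close (x y : K) : nanorm (x - y) < nanorm y -> nanorm x = nanorm y.
Proof.
move=> xy; apply/eqP; rewrite eq_le; apply/andP; split.
  by rewrite -(subrK y x); apply: nanormD_le => //; exact: ltW.
rewrite leNgt; apply/negP => xly; rewrite nanormDist in xy.
by have := nanormD_lt xy xly; rewrite subrK ltxx.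
Qed.

(** The ratio th measures the gap between the norm and the terms below it. There is
    one because the terms tend to zero, and it becomes the rate of convergence of
    the division. *)
Record dominant f (M th : R) (S : {fset Zn}) : Prop := Dominant {
  dominant_gt0 : 0 < M;
  dominant_ratio : 0 < th < 1;
  dominant_neq0 : S != fset0;
  dominant_eq : forall i, i \in S -> wnorm rho f i = M;
  dominant_le : forall i, i \notin S -> wnorm rho f i <= th * M
}.

Lemma dominant_exists f : f != 0 -> exists M th S, dominant f M th S.
Proof.
move=> f0; have [i0 fi0] : exists i, f i != 0.
  apply: contrapT => h; case/eqP: f0; apply/laurentP => i; rewrite lcoef0.
  by apply/eqP/negPn/negP => fi; apply: h; exists i.
have c0 : 0 < wnorm rho f i0.
  by rewrite mulr_gt0 ?radius_exp_gt0// lt_neqAle eq_sym nanorm_eq0 fi0 nanorm_ge0.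
have c20 : 0 < wnorm rho f i0 / 2 by rewrite divr_gt0.
have [B hB] := decaying_cofinite (lcoef_decaying f) c20.
have i0B : i0 \in B by apply: contraT => /hB; lra.
have [|i1 i1B i1max] := @seq_argmax _ _ _ (enum_fset B) (wnorm rho f).
  by apply: contraTneq i0B => B0; rewrite -[_ \in B]/(i0 \in enum_fset B) B0.
set M := wnorm rho f i1 in i1max *.
have M0 : 0 < M by apply: lt_le_trans c0 (i1max _ i0B).
pose S := [fset i in B | wnorm rho f i == M].
have [|th /andP[th0 th1] hth] := @seq_gap R _ (enum_fset (B `\` S)) (wnorm rho f) M M0.
  move=> i; rewrite -[_ \in _]/(i \in B `\` S) !inE /= => /andP[/negP iS iB].
  rewrite lt_neqAle i1max// andbT; apply/negP => iM; apply: iS.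
  by rewrite iB iM.
exists M, (Num.max th (1 / 2)), S; split=> //.
- by rewrite lt_max th0 gt_max th1; lra.
- by apply/fset0Pn; exists i1; rewrite !inE /= i1B eqxx.
- by move=> i; rewrite !inE => /andP[_ /eqP].
- move=> i iS; have [iB|/hB iB] := boolP (i \in B).
    apply: le_trans (hth i _) _; last by rewrite ler_pM2r// le_max lexx.
    by rewrite -[_ \in _]/(i \in B `\` S) inE iS.
  apply: (le_trans iB); apply: (@le_trans _ _ (1 / 2 * M)).
    by have := i1max _ i0B; lra.
  by rewrite ler_pM2r// le_max lexx orbT.
Qed.

Lemma dominant_coef_neq0 f M th S i : dominant f M th S -> i \in S -> f i != 0.
Proof.
move=> fd iS; apply/eqP => fi0; have := dominant_eq fd iS.
by rewrite /wnorm fi0 nanorm0 mul0r => /eqP; rewrite eq_sym gt_eqF// (dominant_gt0 fd).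
Qed.

Lemma dominant_gauss f M th S : dominant f M th S -> gauss_le f M.
Proof.
move=> fd i; have /andP[_ th1] := dominant_ratio fd; have M0 := dominant_gt0 fd.
have [iS|iS] := boolP (i \in S); first by rewrite (dominant_eq fd).
by apply: le_trans (dominant_le fd iS) _; rewrite ler_piMl// ltW.
Qed.

(** In the coefficient of the product at i + j, every term other than f i * g j is
    strictly smaller: an exponent of f and one of g with sum i + j cannot both be
    dominant unless they are i and j, since their degrees are bounded by those of
    i and j, and j is the only dominant exponent of g of its degree. *)
Lemma dominant_product f g Mf thf Sf Mg thg Sg (phi : {additive Zn -> int}) i j :
  dominant f Mf thf Sf -> dominant g Mg thg Sg ->
  (forall k, k \in Sg -> phi k = phi j -> k = j) ->
  i \in Sf -> j \in Sg ->
  (forall k, k \in Sf -> phi k <= phi i) -> (forall k, k \in Sg -> phi k <= phi j) ->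
  (f * g) (i + j) != 0.
Proof.
move=> fd gd phi_uniq iS jS imax jmax.
have Mf0 := dominant_gt0 fd; have Mg0 := dominant_gt0 gd.
pose th := Num.max thf thg.
have th1 : th < 1.
  by case/andP: (dominant_ratio fd) => _ ?; case/andP: (dominant_ratio gd) => _ ?;
    rewrite gt_max; apply/andP.
have th0 : 0 <= th by case/andP: (dominant_ratio fd) => ? _; rewrite le_max ltW.
have r0 := radius_exp_gt0 rho (i + j).
have tail : nanorm ((f * g) (i + j) - f i * g j) <= th * (Mf * Mg) / radius_exp rho (i + j).
  have {2}-> : j = i + j - i by rewrite addrC addKr.
  rewrite lcoefM -(big_seq_fset1 +%R i (fun l => f l * g (i + j - l))).
  apply: has_sum_tail; last first.
  - by apply: null_has_sum; apply: null_mul; exact: lcoef_decaying.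
  - move=> l li; rewrite ler_pdivlMr// wnormM.
    have [lf|lf] := boolP (l \in Sf); last first.
      apply: (@le_trans _ _ (thf * Mf * Mg)).
        apply: ler_pM; rewrite ?wnorm_ge0//; first exact: dominant_le fd _ lf.
        exact: dominant_gauss gd _.
      by rewrite mulrA !ler_pM2r// le_max lexx.
    have lg : i + j - l \notin Sg.
      apply/negP => lg; move: li; rewrite inE => /eqP; apply.
      have e1 := imax _ lf; have e2 := jmax _ lg.
      have : phi (i + j - l) = phi j.
        by apply/eqP; rewrite eq_le e2/= raddfB raddfD/= addrAC lerDr subr_ge0.
      move/(phi_uniq _ lg)/eqP; rewrite subr_eq [i + j]addrC.
      by move=> /eqP/addrI.
    apply: (@le_trans _ _ (Mf * (thg * Mg))).
      apply: ler_pM; rewrite ?wnorm_ge0//; first exact: dominant_gauss fd _.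
      exact: dominant_le gd _ lg.
    by rewrite mulrCA ler_pM2r ?mulr_gt0// le_max lexx orbT.
  - by rewrite divr_ge0 ?mulr_ge0// ltW.
apply/eqP => fg0; move: tail; rewrite fg0 sub0r nanormN ler_pdivlMr//.
rewrite -{1}[j](addKr i) [- i + _]addrC wnormM.
rewrite [i + j]addrC addrK (dominant_eq fd iS) (dominant_eq gd jS).
by rewrite leNgt gtr_pMl ?mulr_gt0// th1.
Qed.

End GaussNorm.

(** * Weierstrass division *)

Lemma descend (x y z : int) (m : nat) : 0 <= z -> z < y -> y <= x ->
  (`|x| < m.+1)%N -> 0 <= x - y + z /\ (`|(x - y + z)%R| < m)%N.
Proof. by lia. Qed.

Lemma ascend (x z : int) (m : nat) : 0 < z -> (`|x| < m.+1)%N -> x + z < 0 ->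
  (`|(x + z)%R| < m)%N.
Proof. by lia. Qed.

Section Division.
Context (R : realType) (K : completeNonarchFieldType R) (n : nat).
Context (rho : 'I_n -> {posnum R}).
Local Notation A := (laurent K rho).
Local Notation Zn := 'rV[int]_n.

Context (phi : {additive Zn -> int}) (d : A) (th : R) (S : {fset Zn}) (top : Zn).
Hypothesis d_dom : dominant d 1 th S.
Hypothesis S0 : 0 \in S.
Hypothesis Stop : top \in S.
Hypothesis phi_S : forall s, s \in S -> 0 <= phi s <= phi top.
Hypothesis phi_bot : forall s, s \in S -> phi s = 0 -> s = 0.
Hypothesis phi_top : forall s, s \in S -> phi s = phi top -> s = top.

(** The shape of the remainders of the division by d. As for polynomials, the
    highest dominant degree of d is excluded. *)
Definition low (r : A) : Prop := forall i, r i != 0 -> 0 <= phi i < phi top.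

Definition approx_divides (f : A) (C : R) : Prop := exists q r : A,
  [/\ gauss_le q C, gauss_le r C, low r & gauss_le (f - q * d - r) (th * C)].

Let th01 : 0 <= th < 1.
Proof. by have /andP[/ltW-> ->] := dominant_ratio d_dom. Qed.

Let low0 : low 0. Proof. by move=> i; rewrite lcoef0 eqxx. Qed.

Let lowD r s : low r -> low s -> low (r + s).
Proof.
move=> lr ls i; rewrite lcoefD; have [ri|/lr//] := eqVneq (r i) 0.
by rewrite ri add0r; exact: ls.
Qed.

Let approxD f g C : approx_divides f C -> approx_divides g C ->
  approx_divides (f + g) C.
Proof.
move=> [q [r [qC rC lr fC]]] [q' [r' [qC' rC' lr' gC]]].
exists (q + q'), (r + r'); split; [exact: gauss_leD|exact: gauss_leD|exact: lowD|].
have -> : f + g - (q + q') * d - (r + r') = (f - q * d - r) + (g - q' * d - r').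
  by ring.
exact: gauss_leD.
Qed.

Let approx_small f C : 0 <= C -> gauss_le f (th * C) -> approx_divides f C.
Proof.
move=> C0 fC; exists 0, 0; split; [exact: gauss_le0|exact: gauss_le0|exact: low0|].
by rewrite mul0r !subr0.
Qed.

Let approx_sum (I : Type) (s : seq I) (P : pred I) (F : I -> A) C : 0 <= C ->
  (forall i, P i -> approx_divides (F i) C) ->
  approx_divides (\sum_(i <- s | P i) F i) C.
Proof.
move=> C0 FC; apply: (big_ind (approx_divides^~ C)) => //; last by move=> f g; exact: approxD.
by apply: approx_small => //; apply: gauss_le0; case/andP: th01 => t _; rewrite mulr_ge0.
Qed.

Let approx_multiple q C : gauss_le q C -> approx_divides (q * d) C.
Proof.
move=> qC; exists q, 0; split=> //; first exact: gauss_le0 (gauss_le_ge0 qC).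
rewrite subrr subr0; apply: gauss_le0; case/andP: th01 => t _.
by rewrite mulr_ge0// (gauss_le_ge0 qC).
Qed.

Let rest := restriction (predC [pred i | i \in S]) d.

Let rest_le : gauss_le rest th.
Proof.
move=> i; rewrite /wnorm restrictionE /=; have [iS|iS] := boolP (i \in S).
  by rewrite nanorm0 mul0r; case/andP: th01.
by have := dominant_le d_dom iS; rewrite mulr1.
Qed.

Let split_at (s : Zn) : s \in S ->
  d = monomial rho (d s) s + (\sum_(l <- S `\ s) monomial rho (d l) l + rest).
Proof.
move=> sS; rewrite {1}(restrictionC [pred i | i \in S] d) restriction_fset.
by rewrite (big_fsetD1 s)//= addrA.
Qed.

Let coef_norm s : s \in S -> nanorm (d s) * radius_exp rho s = 1.
Proof. exact: dominant_eq d_dom _. Qed.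

(** Subtracting the multiple of d whose term at s cancels the monomial replaces it
    by monomials at the other dominant exponents of d, and a small error. *)
Let approx_step (a : K) (i s : Zn) (C : R) : s \in S ->
  nanorm a * radius_exp rho i <= C ->
  (forall (b : K) l, l \in S -> l != s -> nanorm b * radius_exp rho (i - s + l) <= C ->
     approx_divides (monomial rho b (i - s + l)) C) ->
  approx_divides (monomial rho a i) C.
Proof.
move=> sS aC IH; have C0 : 0 <= C.
  by apply: le_trans aC; rewrite mulr_ge0 ?nanorm_ge0// ltW// radius_exp_gt0.
have ds := dominant_coef_neq0 d_dom sS.
have nds : nanorm (d s) != 0 by rewrite nanorm_eq0.
have rs0 : radius_exp rho s != 0 by rewrite gt_eqF// radius_exp_gt0.
pose q := monomial rho (a / d s) (i - s).
have norm_as : nanorm (a / d s) * radius_exp rho (i - s) <= C.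
  suff -> : nanorm (a / d s) * radius_exp rho (i - s) = nanorm a * radius_exp rho i by [].
  have -> : radius_exp rho i = radius_exp rho (i - s) * radius_exp rho s.
    by rewrite -radius_expD subrK.
  have -> : nanorm a = nanorm (a / d s) * nanorm (d s) by rewrite -nanormM divfK.
  by rewrite mulrACA coef_norm// mulr1.
have qC : gauss_le q C by exact: gauss_monomial.
have -> : monomial rho a i = q * d +
    (\sum_(l <- S `\ s) monomial rho (- (a / d s * d l)) (i - s + l) - q * rest).
  rewrite {1}(split_at sS) !mulrDr monomial_mul divfK// subrK -addrA.
  rewrite -[LHS]addr0; congr (_ + _).
  rewrite addrACA addrN addr0 mulr_sumr -big_split big1// => l _.
  rewrite monomial_mul; apply/laurentP => k; rewrite lcoefD lcoef0 !monomialE.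
  by case: eqP; rewrite ?addrN ?addr0.
apply: approxD; first exact: approx_multiple.
apply: approxD; last first.
  apply: approx_small => //; apply: gauss_leN; rewrite [th * C]mulrC.
  exact: gauss_leM qC rest_le.
rewrite big_seq; apply: approx_sum => // l; rewrite !inE => /andP[ls lS].
apply: IH => //; rewrite nanormN nanormM radius_expD mulrACA coef_norm// mulr1.
exact: norm_as.
Qed.

(** Cancelling with the top term lowers degrees that are at or above the window and
    never makes them negative; cancelling with the bottom term raises negative
    degrees. Either way the process ends inside the window. *)
Let approx_monomial (a : K) (i : Zn) (C : R) :
  nanorm a * radius_exp rho i <= C -> approx_divides (monomial rho a i) C.
Proof.
have pos m : forall (a : K) i, 0 <= phi i -> (`|phi i| < m)%N ->
    nanorm a * radius_exp rho i <= C -> approx_divides (monomial rho a i) C.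
  elim: m => // m IH {}a {}i i0 im aC.
  have C0 : 0 <= C.
    by apply: le_trans aC; rewrite mulr_ge0 ?nanorm_ge0// ltW// radius_exp_gt0.
  have [ilow|ihigh] := ltP (phi i) (phi top).
    exists 0, (monomial rho a i); split.
    - exact: gauss_le0.
    - exact: gauss_monomial.
    - move=> j; rewrite monomialE; have [->|_] := eqVneq j i; last by rewrite eqxx.
      by rewrite i0.
    - rewrite mul0r subr0 subrr; apply: gauss_le0.
      by case/andP: th01 => t _; rewrite mulr_ge0.
  apply: (approx_step Stop) => // b l lS ltop bC.
  have /andP[l0 lt] := phi_S lS.
  have {}lt : phi l < phi top.
    by rewrite lt_neqAle lt andbT; apply: contra_neq ltop; exact: phi_top.
  have [] := descend l0 lt ihigh im; rewrite -raddfB -raddfD => *.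
  exact: IH.
have neg m : forall (a : K) i, phi i < 0 -> (`|phi i| < m)%N ->
    nanorm a * radius_exp rho i <= C -> approx_divides (monomial rho a i) C.
  elim: m => // m IH {}a {}i i0 im aC.
  apply: (approx_step S0) => // b l lS lbot bC.
  have /andP[l0 lt] := phi_S lS.
  have {}l0 : 0 < phi l.
    rewrite lt_neqAle l0 andbT eq_sym; apply: contra_neq lbot; exact: phi_bot.
  move: bC; rewrite subr0 => bC.
  have [iln|ilp] := ltP (phi (i + l)) 0.
    by apply: IH => //; move: iln; rewrite raddfD; apply: ascend.
  exact: (pos (absz (phi (i + l))).+1).
have [i0|i0] := ltP (phi i) 0; first exact: (neg (absz (phi i)).+1).
exact: (pos (absz (phi i)).+1).
Qed.

Let approx_all f C : 0 < C -> gauss_le f C -> approx_divides f C.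
Proof.
move=> C0 fC; have tC : 0 < th * C.
  by rewrite mulr_gt0//; case/andP: (dominant_ratio d_dom).
have [T hT] := decaying_cofinite (lcoef_decaying f) tC.
rewrite (restrictionC [pred i | i \in T] f) restriction_fset; apply: approxD.
  apply: approx_sum => [|i _]; first exact: ltW.
  apply: approx_monomial; exact: fC.
apply: approx_small; first exact: ltW.
move=> i; rewrite /wnorm restrictionE /=; have [iT|/hT//] := boolP (i \in T).
by rewrite nanorm0 mul0r ltW.
Qed.

(** Iterating the approximate division, the errors decrease geometrically with
    ratio th, so that the partial quotients and remainders converge. *)
Theorem weierstrass_division f C : 0 < C -> gauss_le f C -> exists q r,
  [/\ gauss_le q C, gauss_le r C, low r & f = q * d + r].
Proof.
move=> C0 fC.
have step (p : A * R) : exists qr : A * A, 0 < p.2 -> gauss_le p.1 p.2 ->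
    [/\ gauss_le qr.1 p.2, gauss_le qr.2 p.2, low qr.2 &
        gauss_le (p.1 - qr.1 * d - qr.2) (th * p.2)].
  have [[p0 pC]|h] := pselect (0 < p.2 /\ gauss_le p.1 p.2).
    by have [q [r ?]] := approx_all p0 pC; exists (q, r).
  by exists (0, 0) => ? ?; exfalso; apply: h.
have {step}[qr qrP] := choice step.
have thp : 0 < th by case/andP: (dominant_ratio d_dom).
pose err := fix err k := if k is k'.+1 then
  err k' - (qr (err k', C * th ^+ k')).1 * d - (qr (err k', C * th ^+ k')).2 else f.
pose q k := (qr (err k, C * th ^+ k)).1; pose r k := (qr (err k, C * th ^+ k)).2.
have Cth k : 0 < C * th ^+ k by rewrite mulr_gt0// exprn_gt0.
have errC k : gauss_le (err k) (C * th ^+ k).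
  elim: k => [|k IH]; first by rewrite expr0 mulr1.
  by have [_ _ _] := qrP (err k, C * th ^+ k) (Cth k) IH; rewrite exprS mulrCA.
have stepP k := qrP (err k, C * th ^+ k) (Cth k) (errC k).
have qC k : gauss_le (q k) (C * th ^+ k) by case: (stepP k).
have rC k : gauss_le (r k) (C * th ^+ k) by case: (stepP k).
have [sq [sqC _]] := gauss_series th01 C0 qC.
have [sr [srC sr_low]] := gauss_series th01 C0 rC.
exists sq, sr; split.
- by have := sqC 0%N; rewrite big_ord0 subr0 expr0 mulr1.
- by have := srC 0%N; rewrite big_ord0 subr0 expr0 mulr1.
- move=> i; apply: contra_neqT => ni; apply: sr_low => k.
  have [_ _ lk _] := stepP k; apply/eqP; apply: contraNT ni; exact: lk.
- have errE k : err k = f - (\sum_(l < k) q l) * d - \sum_(l < k) r l.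
    elim: k => [|k IH]; first by rewrite !big_ord0 mul0r !subr0.
    rewrite !big_ord_recr /= {1}IH -/(q k) -/(r k); ring.
  apply/eqP; rewrite -subr_eq0 opprD addrA; apply/eqP; apply: gauss_le_eq0 => e e0.
  have [k /ltW ke] := geometric_small th01 C0 e0; apply: gauss_leW ke _.
  have -> : f - sq * d - sr =
      err k - (sq - \sum_(l < k) q l) * d - (sr - \sum_(l < k) r l).
    by rewrite errE; ring.
  apply: gauss_leB => //; apply: gauss_leB => //.
  by rewrite -[_ * th ^+ k]mulr1; apply: gauss_leM; [exact: sqC|exact: dominant_gauss d_dom].
Qed.

End Division.

(** * The domain of Laurent series and its degree-zero subrings *)

Section Units.
Context (T : comNzRingType).

Definition has_inverse : {pred T} := [pred x | `[< exists y, y * x = 1 >]].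

Definition inverse (x : T) : T :=
  if pselect (exists y, y * x = 1) is left h then projT1 (cid h) else x.

Lemma inverse_left : {in has_inverse, left_inverse 1 inverse *%R}.
Proof.
move=> x /asboolP xu; rewrite /inverse; case: pselect => // h.
by case: (cid h).
Qed.

Lemma has_inverseP (x y : T) : y * x = 1 -> has_inverse x.
Proof. by move=> yx; apply/asboolP; exists y. Qed.

Lemma inverse_out : {in [predC has_inverse], inverse =1 id}.
Proof. by move=> x /asboolP xu; rewrite /inverse; case: pselect. Qed.
End Units.

Section Domain.
Context (R : realType) (K : completeNonarchFieldType R) (n : nat).
Context (rho : 'I_n -> {posnum R}).
Local Notation A := (laurent K rho).
Local Notation Zn := 'rV[int]_n.
Implicit Types (f g : A) (i j : Zn).

(** The product of the dominant terms of top degree survives, for a linear form that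
    separates the dominant exponents of one factor. *)
Lemma laurent_integral : GRing.integral_domain_axiom A.
Proof.
move=> f g fg; apply/orP; have [f0|f0] := eqVneq f 0; [by left|right].
apply/negPn/negP => g0.
have [Mf [thf [Sf fd]]] := dominant_exists f0.
have [Mg [thg [Sg gd]]] := dominant_exists g0.
have [phi [phi_inj _]] := separating_form (enum_fset Sg).
have [i iS imax] := fset_argmax phi (dominant_neq0 fd).
have [j jS jmax] := fset_argmax phi (dominant_neq0 gd).
have /eqP := dominant_product fd gd
  (fun k kS => phi_inj k j kS jS) iS jS imax jmax.
by rewrite fg lcoef0.
Qed.

End Domain.

HB.instance Definition _ (R : realType) (K : completeNonarchFieldType R) n
    (rho : 'I_n -> {posnum R}) :=
  GRing.ComNzRing_hasMulInverse.Build (laurent K rho)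
    (@inverse_left _) (@has_inverseP _) (@inverse_out _).
HB.instance Definition _ (R : realType) (K : completeNonarchFieldType R) n
    (rho : 'I_n -> {posnum R}) :=
  GRing.ComUnitRing_isIntegral.Build (laurent K rho) (@laurent_integral R K n rho).

Section DegreeZero.
Context (R : realType) (K : completeNonarchFieldType R) (n : nat).
Context (rho : 'I_n -> {posnum R}) (phi : {additive 'rV[int]_n -> int}).
Local Notation A := (laurent K rho).
Local Notation Zn := 'rV[int]_n.
Implicit Types (f g : A) (i j : Zn).

Definition homogeneous (l : int) f : Prop := forall i, f i != 0 -> phi i = l.

Lemma support_mul f g k : (f * g) k != 0 -> exists i, f i != 0 /\ g (k - i) != 0.
Proof.
move=> fgk; apply: contrapT => h; case/eqP: fgk; rewrite lcoefM; apply: has_sumE.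
have := @has_sum_fin _ _ _ (fun i => f i * g (k - i)) fset0.
rewrite big_seq_fset0; apply => i _; apply/eqP; rewrite mulf_eq0.
by apply/negPn/negP => /norP[fi gi]; apply: h; exists i.
Qed.

Lemma homogeneousM l m f g : homogeneous l f -> homogeneous m g ->
  homogeneous (l + m) (f * g).
Proof.
move=> fl gm k /support_mul[i [/fl fi /gm]]; rewrite raddfB/= fi => <-.
by rewrite addrC subrK.
Qed.

Definition degree_zero : {pred A} := [pred f | `[< homogeneous 0 f >]].

Lemma degree_zero_closed : subring_closed degree_zero.
Proof.
split=> [|f g /asboolP f0 /asboolP g0|f g /asboolP f0 /asboolP g0]; apply/asboolP.
- by move=> i; rewrite lcoef1; have [-> _|_] := eqVneq i 0; rewrite ?raddf0 ?eqxx.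
- move=> i; rewrite lcoefD lcoefN; have [fi|/f0//] := eqVneq (f i) 0.
  by rewrite fi add0r oppr_eq0; exact: g0.
- by rewrite -[0]addr0; exact: homogeneousM.
Qed.

HB.instance Definition _ := GRing.isSubringClosed.Build A degree_zero degree_zero_closed.

Record degree_zero_ring : Type := DegreeZero {
  degree_zero_val :> A;
  degree_zero_valP : degree_zero_val \in degree_zero
}.

HB.instance Definition _ := [isSub for degree_zero_val].
HB.instance Definition _ := [Choice of degree_zero_ring by <:].
HB.instance Definition _ := [SubChoice_isSubComNzRing of degree_zero_ring by <:].
HB.instance Definition _ := GRing.ComNzRing_hasMulInverse.Build degree_zero_ring
    (@inverse_left _) (@has_inverseP _) (@inverse_out _).

Lemma degree_zero_integral : GRing.integral_domain_axiom degree_zero_ring.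
Proof.
move=> a b ab; have /eqP : val a * val b = 0 by rewrite -rmorphM ab rmorph0.
by rewrite mulf_eq0 => /orP[]/eqP h; apply/orP; [left|right];
  apply/eqP/val_inj; rewrite h rmorph0.
Qed.
HB.instance Definition _ :=
  GRing.ComUnitRing_isIntegral.Build degree_zero_ring degree_zero_integral.

End DegreeZero.

Section DominantUnits.
Context (R : realType) (K : completeNonarchFieldType R) (n : nat).
Context (rho : 'I_n -> {posnum R}).
Local Notation A := (laurent K rho).
Local Notation Zn := 'rV[int]_n.
Implicit Types (f g : A) (i j : Zn).

Lemma radius_exp0 : radius_exp rho 0 = 1.
Proof. by rewrite /radius_exp big1// => k _; rewrite mxE expr0z. Qed.

Lemma normalize_dominant f M th S s : dominant f M th S -> s \in S ->
  dominant (monomial rho (f s)^-1 (- s) * f) 1 th [fset l - s | l in S].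
Proof.
move=> fd sS; have M0 := dominant_gt0 fd.
have wE k : wnorm rho (monomial rho (f s)^-1 (- s) * f) k = wnorm rho f (k + s) / M.
  rewrite -(dominant_eq fd sS) /wnorm monomialM opprK radius_expD nanormM.
  have fs0 : nanorm (f s) != 0 by rewrite nanorm_eq0 (dominant_coef_neq0 fd sS).
  have -> : nanorm (f s)^-1 = (nanorm (f s))^-1.
    by apply: (mulfI fs0); rewrite -nanormM !divff// -?nanorm_eq0// nanorm1.
  have rs0 : radius_exp rho s != 0 by rewrite gt_eqF// radius_exp_gt0.
  field; exact/andP.
split=> //; first exact: dominant_ratio fd.
- by apply/fset0Pn; exists (s - s); apply/imfsetP; exists s.
- move=> k /imfsetP[l /= lS ->]; rewrite wE subrK (dominant_eq fd lS).
  by rewrite divff// gt_eqF.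
- move=> k kS; rewrite wE mulr1 ler_pdivrMr//; apply: (dominant_le fd).
  apply: contraNN kS => kS; apply/imfsetP; exists (k + s) => //=.
  by rewrite addrK.
Qed.

(** With a single dominant term the window of the division is empty, so 1 is a
    multiple of the series. *)
Lemma dominant_point_unit f M th i : dominant f M th [fset i] -> f \is a GRing.unit.
Proof.
move=> fd; have iS : i \in [fset i] by rewrite inE.
have := normalize_dominant fd iS; set d := _ * f => dd.
have [phi _] := @separating_form n [::].
have S0 : 0 \in [fset l - i | l in [fset i]].
  by apply/imfsetP; exists i; rewrite ?subrr.
have S0E s : s \in [fset l - i | l in [fset i]] -> s = 0.
  by move=> /imfsetP[l /=]; rewrite inE => /eqP -> ->; rewrite subrr.
have one1 : gauss_le (1 : A) 1.
  by rewrite -monomial1; apply: gauss_monomial => //; rewrite nanorm1 radius_exp0 mulr1.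
have [s sS|s sS|s sS|q [r [_ _ rlow E]]] :=
  @weierstrass_division _ K n rho phi d th _ 0 dd S0 S0 _ _ _ 1 1 ltr01 one1.
- by rewrite (S0E s sS) raddf0.
- by move=> _; exact: S0E.
- by move=> _; exact: S0E.
have r0 : r = 0.
  apply/laurentP => k; rewrite lcoef0; apply/eqP/negPn/negP => /rlow.
  by rewrite raddf0; lia.
apply/unitrPr; exists (q * monomial rho (f i)^-1 (- i)).
by rewrite E r0 addr0 /d mulrC mulrA.
Qed.

Lemma dominant_pointD f g th i : dominant f 1 th [fset i] -> gauss_le g th ->
  dominant (f + g) 1 th [fset i].
Proof.
move=> fd gth; have /andP[th0 th1] := dominant_ratio fd.
have i0 := radius_exp_gt0 rho i.
split=> // [||k|k].
- exact: dominant_ratio fd.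
- exact: dominant_neq0 fd.
- rewrite inE => /eqP ->; rewrite -(dominant_eq fd (fset11 i)) /wnorm.
  congr (_ * _); apply: nanorm_close; rewrite lcoefD addrAC subrr add0r.
  rewrite -(ltr_pM2r i0); apply: (le_lt_trans (gth i)).
  by rewrite -/(wnorm rho f i) (dominant_eq fd (fset11 i)).
- move=> ki; have /le_trans := dominant_le fd ki; rewrite mulr1 => fk.
  have /gauss_leP gk := gth.
  rewrite /wnorm -ler_pdivlMr ?radius_exp_gt0// lcoefD; apply: nanormD_le => //.
  by rewrite ler_pdivlMr ?radius_exp_gt0//; exact: fk.
Qed.

Lemma dominant_component f th S s (P : pred Zn) : dominant f 1 th S -> s \in S -> P s ->
  (forall l, l \in S -> P l -> l = s) -> dominant (restriction P f) 1 th [fset s].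
Proof.
move=> fd sS Ps Puniq; have /andP[th0 _] := dominant_ratio fd; split=> //.
- exact: dominant_ratio fd.
- by apply/fset0Pn; exists s; rewrite inE.
- by move=> k; rewrite inE => /eqP ->; rewrite /wnorm restrictionE Ps; exact: dominant_eq fd _ sS.
- move=> k; rewrite inE => ks; rewrite /wnorm restrictionE; case: ifP => Pk.
    apply: (dominant_le fd); apply: contraNN ks => kS.
    by rewrite (Puniq k).
  by rewrite nanorm0 mul0r mulr1 ltW.
Qed.
End DominantUnits.

Section Evaluation.
Context (R : realType) (K : completeNonarchFieldType R) (n : nat).
Context (rho : 'I_n -> {posnum R}) (phi : {additive 'rV[int]_n -> int}) (e : 'rV[int]_n).
Hypothesis phi_e : phi e = 1.
Local Notation A := (laurent K rho).
Local Notation Zn := 'rV[int]_n.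
Local Notation B := (degree_zero_ring K rho phi).
Implicit Types (f g : A) (i j : Zn) (p : {poly B}).

Definition evaluation : {rmorphism {poly B} -> A} :=
  horner_eval (monomial rho 1 e) \o map_poly (val : B -> A).

Lemma degree_zero_coef (a : B) i : phi i != 0 -> val a i = 0.
Proof.
move=> i0; have /asboolP a0 := degree_zero_valP a.
by apply/eqP/negPn/negP => /a0/eqP; apply/negP.
Qed.

Lemma evaluationE p i :
  evaluation p i = \sum_(l < size p) val p`_l (i - e *+ l).
Proof.
rewrite /evaluation /= /horner_eval horner_coef lcoef_sum.
rewrite size_map_inj_poly ?rmorph0//; last exact: val_inj.
apply: eq_bigr => l _; rewrite coef_map_id0; last exact: (rmorph0 (val : B -> A)).
suff -> : monomial rho (1 : K) e ^+ l = monomial rho 1 (e *+ l).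
  by rewrite mulrC monomialM mul1r.
elim: (nat_of_ord l) => [|m IH]; first by rewrite expr0 mulr0n monomial1.
by rewrite exprS IH monomial_mul mulr1 mulrS.
Qed.

Lemma evaluation_coef p (l : nat) i : phi i = l -> evaluation p i = val p`_l (i - e *+ l).
Proof.
move=> il; rewrite evaluationE.
have phi_ne m : m != l -> phi (i - e *+ m) != 0.
  by move=> ml; rewrite raddfB raddfMn/= phi_e il natz subr_eq0 eqz_nat eq_sym.
have [lp|pl] := ltnP l (size p).
  rewrite (bigD1 (Ordinal lp))//= big1 ?addr0// => m ml.
  by apply: degree_zero_coef; apply: phi_ne.
rewrite nth_default// rmorph0 lcoef0 big1// => m _.
by apply/degree_zero_coef/phi_ne; rewrite ltn_eqF// (leq_trans _ pl).
Qed.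

Lemma evaluation_support p i : evaluation p i != 0 -> 0 <= phi i < size p.
Proof.
move=> pi; have [l /eqP il] : exists l : 'I_(size p), phi i == l.
  apply: contrapT => h; case/eqP: pi; rewrite evaluationE big1// => l _.
  apply: degree_zero_coef; rewrite raddfB raddfMn/= phi_e natz subr_eq0.
  by apply/negP => il; apply: h; exists l.
by rewrite il lez_nat ltz_nat ltn_ord.
Qed.

(** The homogeneous components of f, shifted to degree zero, are the
    coefficients. *)
Lemma evaluation_onto f (N : nat) : (forall i, f i != 0 -> 0 <= phi i < N) ->
  exists2 p : {poly B}, (size p <= N)%N & evaluation p = f.
Proof.
move=> fN; pose c (l : nat) :=
  restriction [pred i | phi i == l] f * monomial rho 1 (- (e *+ l)).
have c0 l : c l \in degree_zero phi.
  apply/asboolP; rewrite -(subrr l%:Z); apply: homogeneousM.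
    by move=> i; rewrite restrictionE /=; case: ifP => [/eqP//|]; rewrite eqxx.
  move=> i; rewrite monomialE; have [->|_] := eqVneq i _; last by rewrite eqxx.
  by rewrite raddfN raddfMn/= phi_e natz.
pose p := \poly_(l < N) DegreeZero (c0 l).
have pN : (size p <= N)%N by exact: size_poly.
exists p => //; apply/laurentP => i.
have [iN|iN] := boolP (0 <= phi i < N).
  have [l il] : exists l : nat, phi i = l.
    by case/andP: iN => i0 _; exists `|phi i|%N; rewrite gez0_abs.
  move: iN; rewrite il lez_nat ltz_nat => /= lN.
  rewrite (evaluation_coef p il) coef_poly lN -[val _]/(c l) /c mulrC monomialM opprK subrK.
  rewrite mul1r.
  by rewrite restrictionE /= il eqxx.
have -> : f i = 0 by apply/eqP/negPn/negP => /fN; apply/negP.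
apply/eqP/negPn/negP => /evaluation_support /andP[i0 ip]; case/negP: iN.
by rewrite i0 (lt_le_trans ip)// lez_nat.
Qed.

Lemma evaluationC (c : B) : evaluation c%:P = val c.
Proof.
rewrite /evaluation /= /horner_eval.
by rewrite (map_polyC (val : {rmorphism B -> A})) hornerC.
Qed.

End Evaluation.

(** * Nonzero series are Weierstrass divisors *)

Section Weierstrass.
Context (R : realType) (K : completeNonarchFieldType R) (n : nat).
Context (rho : 'I_n -> {posnum R}).
Local Notation A := (laurent K rho).
Local Notation Zn := 'rV[int]_n.
Implicit Types (f g : A) (i j : Zn).

Section Normalized.
Context (phi : {additive 'rV[int]_n -> int}) (e : 'rV[int]_n).
Hypothesis phi_e : phi e = 1.
Local Notation B := (degree_zero_ring K rho phi).
Local Notation ev := (evaluation K rho phi e).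
Context (d : A) (th : R) (S : {fset Zn}) (top : Zn) (D : nat).
Hypothesis d_dom : dominant d 1 th S.
Hypothesis S0 : 0 \in S.
Hypothesis Stop : top \in S.
Hypothesis phi_D : phi top = D.
Hypothesis phi_S : forall s, s \in S -> 0 <= phi s <= phi top.
Hypothesis phi_bot : forall s, s \in S -> phi s = 0 -> s = 0.
Hypothesis phi_top : forall s, s \in S -> phi s = phi top -> s = top.

(** The degree-zero part of the inverse is an inverse too. *)
Lemma degree_zero_unit (a : B) : val a \is a GRing.unit -> a \is a GRing.unit.
Proof.
move=> au; pose c := restriction [pred i | phi i == 0] (val a)^-1.
have c0 : c \in degree_zero phi.
  by apply/asboolP => i; rewrite restrictionE /=; case: ifP => [/eqP//|]; rewrite eqxx.
apply/unitrPr; exists (DegreeZero c0); apply: val_inj; rewrite rmorphM rmorph1 /=.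
apply/laurentP => k; have [k0|k0] := eqVneq (phi k) 0; last first.
  have /asboolP a0 := degree_zero_valP a; have /asboolP c0' := c0.
  have := homogeneousM a0 c0'; rewrite addr0 => /(_ k) ac0.
  rewrite lcoef1; have [kE|_] := eqVneq k 0; first by rewrite kE raddf0 eqxx in k0.
  by apply/eqP/negPn/negP => /ac0/eqP; apply/negP.
rewrite -(divrr au) !lcoefM; congr infsum; apply/funext => i.
have [->|ai] := eqVneq (val a i) 0; first by rewrite !mul0r.
have /asboolP/(_ i ai) i0 := degree_zero_valP a.
by rewrite restrictionE /= raddfB/= k0 i0 subrr eqxx.
Qed.

(** Dividing the difference between d and its truncation to the window by d gives a
    small quotient q, so 1 + q is a unit and d (1 + q) is supported in the closed
    window. Its extreme components have the same single dominant term as those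
    of d, which makes the extreme coefficients units. *)
Lemma weierstrass_polynomial : exists u (w : {poly B}),
  [/\ w \is monic, w`_0 \is a GRing.unit, size w = D.+1, u \is a GRing.unit &
      ev w = d * u].
Proof.
have /andP[th0 th1] := dominant_ratio d_dom.
pose P : pred Zn := [pred i | 0 <= phi i <= phi top].
have small : gauss_le (restriction P d - d) th.
  move=> i; rewrite /wnorm lcoefD lcoefN restrictionE; case: ifP => iP.
    by rewrite addrN nanorm0 mul0r ltW.
  rewrite add0r nanormN -[th]mulr1; apply: (dominant_le d_dom).
  by apply: contraFN iP => /phi_S.
have [q [r [qth rth rlow E]]] :=
  weierstrass_division d_dom S0 Stop phi_S phi_bot phi_top th0 small.
pose u := 1 + q.
have uu : u \is a GRing.unit.
  apply: (@dominant_point_unit _ _ _ _ _ 1 th 0); apply: dominant_pointD => //.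
  split=> //; first by rewrite th0.
  - by apply/fset0Pn; exists 0; rewrite inE.
  - by move=> k; rewrite inE => /eqP ->; rewrite /wnorm lcoef1 eqxx nanorm1 radius_exp0 mulr1.
  - by move=> k; rewrite inE /wnorm lcoef1 => /negbTE ->; rewrite nanorm0 mul0r mulr1 ltW.
pose w' := restriction P d - r.
have w'E : w' = d * u.
  rewrite /w' /u mulrDr mulr1 -[restriction P d](subrK d) E; ring.
have w'supp i : w' i != 0 -> 0 <= phi i < D.+1.
  rewrite lcoefD lcoefN restrictionE; have [|iP] := boolP (P i).
    by rewrite /P /= phi_D => iP _; lia.
  rewrite add0r oppr_eq0 => /rlow; rewrite phi_D; lia.
have [p pD evp] := evaluation_onto phi_e w'supp.
have coef_unit (l : nat) s : s \in S -> phi s = l ->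
    (forall t, t \in S -> phi t = l -> t = s) -> p`_l \is a GRing.unit.
  move=> sS sl s_uniq; apply: degree_zero_unit.
  pose Pl : pred Zn := [pred i | phi i == l].
  have pE : val p`_l = monomial rho 1 (- (e *+ l)) * restriction Pl w'.
    apply/laurentP => k; rewrite monomialM mul1r opprK restrictionE.
    rewrite -[Pl _]/(phi (k + e *+ l) == l).
    have kl : phi (k + e *+ l) = phi k + l by rewrite raddfD raddfMn/= phi_e natz.
    rewrite kl -[X in _ == X]add0r (inj_eq (addIr _)).
    case: eqP => [k0|/eqP k0]; last exact: degree_zero_coef.
    rewrite k0 add0r in kl.
    by rewrite -evp (evaluation_coef phi_e p kl) addrK.
  have m_unit : monomial rho (1 : K) (- (e *+ l)) \is a GRing.unit.
    apply/unitrPr; exists (monomial rho 1^-1 (- - (e *+ l))).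
    by rewrite monomial_unit// oner_neq0.
  rewrite pE unitrM m_unit /=.
  have -> : restriction Pl w' = restriction Pl d - restriction Pl r.
    apply/laurentP => k; rewrite lcoefD lcoefN !restrictionE lcoefD lcoefN restrictionE.
    rewrite /Pl /=; case: eqP => [kl|_]; last by rewrite subrr.
    by rewrite /P /= kl -sl phi_S.
  apply: (@dominant_point_unit _ _ _ _ _ 1 th s); apply: dominant_pointD.
    apply: (dominant_component d_dom) => //; first by rewrite /Pl /= sl.
    by move=> t tS /eqP; exact: s_uniq.
  exact/gauss_leN/gauss_restriction.
have pDu : p`_D \is a GRing.unit
  by apply: (coef_unit D top) => // t tS; rewrite -phi_D; exact: phi_top.
have p0u : p`_0 \is a GRing.unit.
  by apply: (coef_unit 0%N 0) => //; rewrite raddf0.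
have pD0 : p`_D != 0 by apply: contraTneq pDu => ->; rewrite unitr0.
have szp : size p = D.+1.
  apply/eqP; rewrite eqn_leq pD /= ltnNge; apply: contra pD0 => h.
  by rewrite nth_default.
pose c : B := (p`_D)^-1; have cu : c \is a GRing.unit by rewrite unitrV.
have c0 : c != 0 by apply: contraTneq cu => ->; rewrite unitr0.
exists (u * val c), (c *: p); split.
- by rewrite monicE lead_coefZ lead_coefE szp /= mulVr.
- by rewrite coefZ unitrM cu.
- by rewrite size_scale.
- by rewrite unitrM uu /=; exact: (rmorph_unit (val : B -> A)).
- rewrite -mul_polyC rmorphM evp w'E.
  by rewrite evaluationC mulrC mulrA.
Qed.

(** Uniqueness: if q <> 0, its dominant terms of extreme degree produce terms of
    q w whose degrees are too far apart for a remainder. *)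
Lemma normalized_weierstrass_divisor : weierstrass_divisor d.
Proof.
have [u [w [wm w0 szw uu evw]]] := weierstrass_polynomial.
exists B, ev, w; split=> //; first by exists u.
  move=> f; have [C C0 fC] := gauss_bounded f.
  have [q [r [_ _ rlow fE]]] :=
    weierstrass_division d_dom S0 Stop phi_S phi_bot phi_top C0 fC.
  have [|p pD evp] := @evaluation_onto _ _ _ _ _ _ phi_e r D.
    by move=> i /rlow; rewrite phi_D.
  exists (q * u^-1), p; split; first by rewrite szw ltnS.
  by rewrite evp evw mulrCA divrK// mulrC.
move=> q r; rewrite szw ltnS => szr qr.
have q0 : q = 0.
  apply/eqP/negPn/negP => q0; pose q' := q * u.
  have q'0 : q' != 0.
    by rewrite mulf_neq0//; apply: contraTneq uu => ->; rewrite unitr0.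
  have q'd : q' * d = - ev r.
    by apply/eqP; rewrite -addr_eq0 -qr evw /q'; apply/eqP; ring.
  have supp i : (q' * d) i != 0 -> 0 <= phi i < D.
    rewrite q'd lcoefN oppr_eq0 => /(evaluation_support phi_e)/andP[-> h] /=.
    by apply: lt_le_trans h _; rewrite lez_nat.
  have [M [t [Sq qdom]]] := dominant_exists q'0.
  have [i iS imax] := fset_argmax phi (dominant_neq0 qdom).
  have [j jS jmin] := fset_argmax (fun l => - phi l) (dominant_neq0 qdom).
  have := dominant_product qdom d_dom phi_top iS Stop imax
    (fun k kS => proj2 (andP (phi_S kS))).
  (* the bottom degrees are the top degrees for the opposite form *)
  have := dominant_product (phi := -%R \o phi) (i := j) (j := 0) qdom d_dom.
  rewrite addr0 /= => bottom /supp/andP[_]; rewrite raddfD/= phi_D => itop.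
  have /supp/andP[j0 _] : (q' * d) j != 0.
    apply: bottom => // [k kS|k kS].
      by rewrite raddf0 oppr0 => /eqP; rewrite oppr_eq0 => /eqP; exact: phi_bot.
    by rewrite raddf0 oppr0 oppr_le0; case/andP: (phi_S kS).
  by have := imax _ jS; lia.
split=> //; move: qr; rewrite q0 mul0r add0r => evr.
apply/polyP => l; rewrite coef0; apply: val_inj; apply/laurentP => k.
rewrite rmorph0 lcoef0; have [k0|] := eqVneq (phi k) 0; last exact: degree_zero_coef.
have kl : phi (k + e *+ l) = l by rewrite raddfD raddfMn/= phi_e natz k0 add0r.
by have := evaluation_coef phi_e r kl; rewrite addrK evr lcoef0 => <-.
Qed.

End Normalized.

(** A monomial factor brings the dominant exponent of lowest degree to 0 and the
    Gauss norm to 1. *)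
Theorem laurent_weierstrass_divisor (n_gt0 : (0 < n)%N) (d : A) :
  d != 0 -> weierstrass_divisor d.
Proof.
move=> d0; have [M [th [S ddom]]] := dominant_exists d0.
have [phi [phi_inj /(_ n_gt0)[e phi_e]]] := separating_form (enum_fset S).
have [s1 s1S s1max] := fset_argmax phi (dominant_neq0 ddom).
have [s0 s0S s0min] := fset_argmax (fun l => - phi l) (dominant_neq0 ddom).
have {}s0min l : l \in S -> phi s0 <= phi l by move=> /s0min; rewrite lerN2.
have nd := normalize_dominant ddom s0S.
pose c := monomial rho (d s0)^-1 (- s0).
have cu : c \is a GRing.unit.
  apply/unitrPr; exists (monomial rho (d s0)^-1^-1 (- - s0)).
  by rewrite monomial_unit// invr_eq0 (dominant_coef_neq0 ddom).
have [D phiD] : exists D : nat, phi (s1 - s0) = D.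
  by exists (absz (phi (s1 - s0))); rewrite gez0_abs// raddfB subr_ge0 s0min.
have [||||||R' [ev [w [wm w0 [u uu evw] div divU]]]] :=
  @normalized_weierstrass_divisor phi e phi_e _ th _ (s1 - s0) D nd.
- by apply/imfsetP; exists s0; rewrite ?subrr.
- by apply/imfsetP; exists s1.
- exact: phiD.
- move=> _ /imfsetP[l /= lS ->]; rewrite !raddfB subr_ge0 s0min//=.
  by rewrite lerD2r s1max.
- move=> _ /imfsetP[l /= lS ->] /eqP; rewrite raddfB subr_eq0 => /eqP.
  by move=> /(phi_inj _ _ lS s0S) ->; rewrite subrr.
- move=> _ /imfsetP[l /= lS ->] /eqP; rewrite !raddfB (inj_eq (addIr _)) => /eqP.
  by move=> /(phi_inj _ _ lS s1S) ->.
exists R', ev, w; split=> //; exists (c * u); first by rewrite unitrM cu.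
by rewrite evw -/c mulrA [d * c]mulrC.
Qed.
End Weierstrass.

(** * Freeness of finite projective modules *)

Theorem corollary1p17 (R : realType) (p : nat) (K : completeNonarchFieldType R)
    (hK : mixed_characteristic K p) (hp : nanorm (p%:R : K) = p%:R^-1)
    (n : nat) (hn : (0 < n)%N) (rho : 'I_n -> {posnum R})
    (M : lmodType (laurent K rho)) :
  finitely_generated M -> projective M -> free_module M.
Proof.
apply: projective_free => m e ee.
exact: (idempotent_free (laurent_weierstrass_divisor hn) ee).
Qed.
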